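(* Let $L$ be an even lattice of signature $(l,l)$ with $L\otimes\mathbb{R}=L^+\oplus L^-$ a decomposition into isotropic subspaces of dimension $l$, and let $V_{NS}$ be the associated $N=2$ vertex operator superalgebra. Then the space $$\widetilde P^{0,0}=P^{0,0}\big/\big(G^+_{-1/2}V_{-1/2,-1}+G^-_{-1/2}V_{-1/2,1}\big)\cap P^{0,0}$$ with the bracket $$[u,v]=\mathrm{Res}_z\,Y(G^+_{-1/2}G^-_{-1/2}u,z)v$$ is a (well-defined) Lie algebra.
   Context: $V_{r,s}=\{v\in V_{NS}:L_0v=rv,\ J_0v=sv\}$ and $P^{i,j}=\{v\in V_{NS}:L_0v=iv,\ J_0v=jv,\ G^\pm_{n-1/2}v=J_nv=0\text{ for all }n>0\}$. Space. Let $h=L\otimes\mathbb{C}$, $\widehat h^-=h\otimes t^{-1}\mathbb{C}[t^{-1}]$, $x(n)=x\otimes t^n$, $V_L=S(\widehat h^-)\otimes\mathbb{C}\{L\}$, where $\mathbb{C}\{L\}$ has basis $e^\lambda$ ($\lambda\in L$) and product $e^\lambda e^\mu=\epsilon(\lambda,\mu)e^{\lambda+\mu}$, $\epsilon$ a $\{\pm1\}$-valued 2-cocycle with $\epsilon(\lambda,\mu)=(-1)^{(\lambda,\mu)}\epsilon(\mu,\lambda)$, $\epsilon(\lambda,-\lambda)=(-1)^{(\lambda,\lambda)/2}$, $\epsilon(0,\lambda)=\epsilon(\lambda,0)=1$. The operators $x(n)$ satisfy $[x(m),y(n)]=m(x,y)\delta_{m+n,0}$, $x(n)e^\lambda=0$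 for $n>0$, and $x(0)$ acts on $S(\widehat h^-)\otimes e^\lambda$ as $(x,\lambda)$. Let $F$ be the exterior algebra on $a_i(-r),a_i^*(-r)$ ($1\le i\le l$, $r\in\frac12+\mathbb{Z}_{\ge0}$), with operators $a_i(r),a_i^*(r)$ ($r\in\frac12+\mathbb{Z}$) satisfying $\{a_i(r),a_j^*(s)\}=\delta_{ij}\delta_{r+s,0}$, $\{a_i(r),a_j(s)\}=\{a_i^*(r),a_j^*(s)\}=0$, those with $r>0$ killing $1$. $V_{NS}=V_L\otimes F$ is a vertex operator superalgebra with $Y(x(-1),z)=\sum_nx(n)z^{-n-1}$, $Y(a(-\frac12),z)=\sum_ra(r)z^{-r-1/2}$ and $Y(e^\lambda,z)=\exp(\sum_{n>0}\frac{\lambda(-n)}nz^n)e^\lambda z^{\lambda(0)}\exp(-\sum_{n>0}\frac{\lambda(n)}nz^{-n})$. $N=2$ structure. Choose bases $h_i^\pm$ of $L^\pm$ with $(h_i^+,h_j^-)=\delta_{ij}$ and put $\omega=\sum_ih_i^+(-1)h_i^-(-1)+\frac12\sum_i\big(a_i(-\frac32)a_i^*(-\frac12)+a_i^*(-\frac32)a_i(-\frac12)\big)$, $\tau^+=\sum_ih_i^+(-1)a_i(-\frac12)$, $\tau^-=\sum_ih_i^-(-1)a_i^*(-\frac12)$, $j=\sum_ia_i(-\frac12)\wedge a_i^*(-\frac12)$; $Y(\omega,z)=\sum L_nz^{-n-2}$, $Y(\tau^\pm,z)=\sum_nG^\pm_{n+1/2}z^{-n-2}$, $Y(j,z)=\sum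 J_nz^{-n-1}$. These operators generate the $N=2$ superconformal algebra with central charge $c=3l$. *)

(* Defs.v *)
From HB Require Import structures.
From mathcomp Require Import all_boot all_order all_algebra finmap.
From mathcomp Require Import complex boolp reals.
From mathcomp.multinomials Require Import monalg.

Set Implicit Arguments.
Unset Strict Implicit.
Unset Printing Implicit Defensive.

Import GRing.Theory Num.Theory.
Import Quotient.Exports.
Local Open Scope ring_scope.
Local Open Scope quotient_scope.
Local Open Scope complex_scope.

(* A lattice of rank [n] is [int^n] with its Gram matrix; its elements, and
   those of [L (x) R] and [L (x) C], are row vectors. *)
Definition gramf (S : pzRingType) n (B : 'M[S]_n) (x y : 'rV[S]_n) : S :=
  (x *m B *m y^T) 0 0.

Definition even_lattice n (A : 'M[int]_n) : Prop :=
  A^T = A /\ forall lam : 'rV[int]_n, (2 %| gramf A lam lam)%Z.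

Definition has_signature (R : realType) p q (A : 'M[int]_(p + q)) : Prop :=
  exists2 P : 'M[R]_(p + q), P \in unitmx &
    P *m map_mx intr A *m P^T = block_mx 1%:M 0 0 (- 1%:M).

Definition isotropic (R : realType) n (A : 'M[int]_n)
    (U : {vspace 'rV[R]_n}) : Prop :=
  {in U &, forall x y, gramf (map_mx intr A) x y = 0}.

Record isotropic_decomposition (R : realType) l (A : 'M[int]_(l + l))
    (Lp Lm : {vspace 'rV[R]_(l + l)}) : Prop := {
  isodec_full : (Lp + Lm)%VS = fullv;
  isodec_direct : directv (Lp + Lm);
  isodec_isop : isotropic A Lp;
  isodec_isom : isotropic A Lm;
  isodec_dimp : \dim Lp = l;
  isodec_dimm : \dim Lm = l
}.

Record lattice_cocycle n (A : 'M[int]_n)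
    (eps : 'rV[int]_n -> 'rV[int]_n -> int) : Prop := {
  cocycle_sign : forall a b, eps a b = 1 \/ eps a b = -1;
  cocycleP : forall a b c, eps a b * eps (a + b) c = eps b c * eps a (b + c);
  cocycle_comm : forall a b, eps a b = (-1) ^ gramf A a b * eps b a;
  cocycle_opp : forall a, eps a (- a) = (-1) ^ (gramf A a a %/ 2)%Z;
  cocycle_0l : forall a, eps 0 a = 1;
  cocycle_0r : forall a, eps a 0 = 1
}.

(* The value of a formally infinite sum with finitely many nonzero terms. *)
Definition sums_to (V : zmodType) (f : nat -> V) (s : V) : Prop :=
  exists N0, forall N, (N0 <= N)%N -> \sum_(j < N) f j = s.

Definition binz (K : fieldType) (m : int) (j : nat) : K :=
  (\prod_(i < j) (m - i%:Z)%:~R) / j`!%:R.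

(* [Y u n v] is the mode [u_(n) v], with [Y(u,z) = \sum_n u_(n) z^(-n-1)];
   [par p] is the subspace of vectors of parity [p] ([true] is odd). The last
   axiom is the Borcherds form of the Jacobi identity. *)
Record vertex_superalgebra (K : fieldType) (V : lmodType K)
    (par : bool -> {pred V}) (vac : V) (Y : V -> int -> {linear V -> V})
    : Prop := {
  va_linear : forall n w, linear (fun u => Y u n w);
  va_vac_even : vac \in par false;
  va_parity : forall p q u v n,
    u \in par p -> v \in par q -> Y u n v \in par (p (+) q);
  va_truncation : forall u v, exists N : int,
    forall n, (N <= n)%R -> Y u n v = 0;
  va_vacuum : forall n v, Y vac n v = if n == -1 then v else 0;
  va_creation : forall u, Y u (-1) vac = u;
  va_creation0 : forall u (n : int), (0 <= n)%R -> Y u n vac = 0;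
  va_borcherds : forall p q u v w (k m n : int),
    u \in par p -> v \in par q ->
    exists2 s,
      sums_to (fun j : nat =>
        binz K m j *: Y (Y u (k + j%:Z) v) (m + n - j%:Z) w) s &
      sums_to (fun j : nat =>
        ((-1) ^+ j * binz K k j) *:
          (Y u (m + k - j%:Z) (Y v (n + j%:Z) w)
           - ((-1) ^+ (p && q) * (-1) ^ k) *:
             Y v (n + k - j%:Z) (Y u (m + j%:Z) w))) s
}.

(* Coefficients of [(\sum_(i >= 0) A_i t^i)^m] and [exp (\sum_(i > 0) A_i t^i)]
   for a sequence of operators; [fexp] is meant for [A_0 = 0], so that the
   powers [m > k] do not contribute to the coefficient of [t^k]. *)
Fixpoint fpow (V : zmodType) (A : nat -> V -> V) (m k : nat) (v : V) : V :=
  if m is m'.+1 then \sum_(i < k.+1) A i (fpow A m' (k - i) v)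
  else if k == 0%N then v else 0.

Definition fexp (K : fieldType) (V : lmodType K) (A : nat -> V -> V)
    (k : nat) (v : V) : V :=
  \sum_(m < k.+1) (m`!%:R)^-1 *: fpow A m k v.

(* [(i, k)] stands for [e_i(-(k+1))], where [e_i] is the [i]-th vector of the
   lattice basis; [(i, false, k)] stands for [a_i(-k-1/2)] and [(i, true, k)]
   for [a_i^*(-k-1/2)]. *)
Definition boson l := ('I_(l + l) * nat)%type.
Definition fermion l := ('I_l * bool * nat)%type.

(* A basis of [S(h^-) (x) C{L} (x) F]: a monomial in the bosons, a lattice
   element, and the exterior product of a finite set of fermions, taken in
   increasing order of their code under [pickle]. *)
Definition fock_basis l :=
  ({cmonom (boson l)} * 'rV[int]_(l + l) * {fset (fermion l)})%type.
HB.instance Definition _ l := Choice.on (fock_basis l).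

Notation VNS K l := {malg K[fock_basis l]}.

Section FockSpace.
Variables (K : fieldType) (l : nat).
Local Notation V := (VNS K l).
Local Notation L := 'rV[int]_(l + l).

Definition parity (p : bool) : {pred V} :=
  [pred v : V | all (fun b : fock_basis l => odd #|` b.2| == p) (msupp v)].

Definition lext (f : fock_basis l -> V) (v : V) : V :=
  \sum_(b <- msupp v) v@_b *: f b.

Definition expv (lam : L) : V := << (onecm _, lam, fset0) : fock_basis l >>.
Definition vac : V := expv 0.

Variable A : 'M[int]_(l + l).

Definition heis_basis (x : 'rV[K]_(l + l)) (n : int) (b : fock_basis l) : V :=
  let: (mon, mu, s) := b in
  match n with
  | Posz 0 => gramf (map_mx intr A) x (map_mx intr mu) *: << b >>
  | Posz k.+1 => \sum_(i < l + l)
      (gramf (map_mx intr A) x (delta_mx 0 i) *+ (k.+1 * mon (i, k))) *: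
        << (divcm mon (ucm (i, k)), mu, s) : fock_basis l >>
  | Negz k => \sum_(i < l + l)
      x 0 i *: << (mulcm mon (ucm (i, k)), mu, s) : fock_basis l >>
  end.

(* [heis x n] is the operator [x(n)]. *)
Definition heis x n : V -> V := lext (heis_basis x n).

Variable eps : L -> L -> int.

Definition emul_basis (lam : L) (b : fock_basis l) : V :=
  let: (mon, mu, s) := b in
  (eps lam mu)%:~R *: << (mon, lam + mu, s) : fock_basis l >>.

(* Multiplication by [e^lam]. *)
Definition emul lam : V -> V := lext (emul_basis lam).

Definition fsign (g : fermion l) (s : {fset (fermion l)}) : K :=
  (-1) ^+ #|` [fset h in s | (choice.pickle h < choice.pickle g)%N]%fset|.

Definition ferm_basis (i : 'I_l) (star : bool) (n : int) (b : fock_basis l)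
    : V :=
  let: (mon, mu, s) := b in
  match n with
  | Posz k => let g := (i, ~~ star, k) in
      if g \in s then fsign g s *: << (mon, mu, (s `\ g)%fset) : fock_basis l >>
      else 0
  | Negz k => let g := (i, star, k) in
      if g \in s then 0
      else fsign g s *: << (mon, mu, (g |` s)%fset) : fock_basis l >>
  end.

(* [ferm i false n] is [a_i(n + 1/2)] and [ferm i true n] is
   [a_i^*(n + 1/2)]. *)
Definition ferm i star n : V -> V := lext (ferm_basis i star n).

(* [\sum_(k > 0) lam(-k)/k z^k] and [- \sum_(k > 0) lam(k)/k z^(-k)]. *)
Definition log_creation (lam : L) (k : nat) (v : V) : V :=
  if k == 0%N then 0 else k%:R^-1 *: heis (map_mx intr lam) (- k%:Z) v.
Definition log_annihilation (lam : L) (k : nat) (v : V) : V :=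
  if k == 0%N then 0 else - (k%:R^-1 *: heis (map_mx intr lam) k%:Z v).

Definition fexpz (B : nat -> V -> V) (k : int) (v : V) : V :=
  if k is Posz k' then fexp B k' v else 0.

(* The fields prescribed for a vertex superalgebra structure on [V_NS]; they
   generate it, so the structure is unique. In [gen_exp], [z^(lam(0))] is
   [z^d] on the vectors [v] such that [lam(0) v = d v], and the [j]-th term of
   the sum is the contribution of [z^(-j)] in
   [exp (- \sum lam(k)/k z^(-k)) v] to the coefficient of [z^(-n-1)]. *)
Record generating_fields (Y : V -> int -> {linear V -> V}) : Prop := {
  gen_heis : forall x n v, Y (heis x (-1) vac) n v = heis x n v;
  gen_ferm : forall i star n v,
    Y (ferm i star (-1) vac) n v = ferm i star n v;
  gen_exp : forall (lam : L) (d n : int) v,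
    heis (map_mx intr lam) 0 v = d%:~R *: v ->
    sums_to (fun j : nat =>
        fexpz (log_creation lam) (j%:Z - d - n - 1)
          (emul lam (fexp (log_annihilation lam) j v)))
      (Y (expv lam) n v)
}.

(* Meant for dual bases of [L^+] and [L^-]. *)
Variables hp hm : 'I_l -> 'rV[K]_(l + l).

Definition omega : V :=
  \sum_(i < l) heis (hp i) (-1) (heis (hm i) (-1) vac)
  + 2%:R^-1 *: \sum_(i < l)
      (ferm i false (-2) (ferm i true (-1) vac)
       + ferm i true (-2) (ferm i false (-1) vac)).

Definition tau_plus : V :=
  \sum_(i < l) heis (hp i) (-1) (ferm i false (-1) vac).

Definition tau_minus : V :=
  \sum_(i < l) heis (hm i) (-1) (ferm i true (-1) vac).

Definition jvec : V := \sum_(i < l) ferm i false (-1) (ferm i true (-1) vac).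

End FockSpace.

Section SubQuotient.
Variables (K : nzRingType) (V : lmodType K) (P N : submodClosed V).

Definition submod_of := {v : V | v \in P}.
HB.instance Definition _ := SubChoice.on submod_of.
HB.instance Definition _ := [SubChoice_isSubLmodule of submod_of by <:].

Definition capmod : {pred submod_of} := [pred w | val w \in N].

Fact capmod_closed : zmod_closed capmod.
Proof.
have capE w : (w \in capmod) = (val w \in N) by [].
split=> [|u v]; rewrite !capE; first by rewrite raddf0 rpred0.
by move=> uN vN; rewrite raddfB /= -scaleN1r rpredD ?rpredZ.
Qed.
HB.instance Definition _ := GRing.isZmodClosed.Build _ capmod capmod_closed.

(* [P / (N `&` P)] *)
Definition subquot := Quotient.quot capmod.
HB.instance Definition _ := GRing.Zmodule.on subquot.

Definition subquot_pi (w : submod_of) : subquot := \pi_subquot w.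

Lemma subquot_piP u v :
  (subquot_pi u = subquot_pi v) <-> (val u - val v \in N).
Proof.
rewrite -raddfB -[_ \in N]/((u - v) \in capmod) Quotient.idealrBE.
by split=> [/eqP|/eqP].
Qed.

Lemma subquot_piK x : subquot_pi (repr x) = x.
Proof. exact: reprK. Qed.

Fact subquot_pi_is_zmod : zmod_morphism subquot_pi.
Proof. exact: (@pi_is_zmod_morphism _ _ _ (Quotient.quot capmod)). Qed.
HB.instance Definition _ :=
  GRing.isZmodMorphism.Build _ _ subquot_pi subquot_pi_is_zmod.

Definition subquot_scale (a : K) (x : subquot) : subquot :=
  subquot_pi (a *: repr x).

Lemma subquot_piZ a u : subquot_scale a (subquot_pi u) = subquot_pi (a *: u).
Proof.
apply/subquot_piP.
suff -> : val (a *: repr (subquot_pi u)) - val (a *: u)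
    = a *: (val (repr (subquot_pi u)) - val u).
  by rewrite rpredZ //; apply/subquot_piP/subquot_piK.
by rewrite scalerBr; congr (_ - _); exact: linearZ.
Qed.

Fact subquot_scaleA a b x :
  subquot_scale a (subquot_scale b x) = subquot_scale (a * b) x.
Proof. by rewrite {2}/subquot_scale subquot_piZ scalerA. Qed.

Fact subquot_scale1 : left_id 1 subquot_scale.
Proof. by move=> x; rewrite /subquot_scale scale1r subquot_piK. Qed.

Fact subquot_scaleDr : right_distributive subquot_scale +%R.
Proof.
move=> a x y; rewrite -[x]subquot_piK -[y]subquot_piK -raddfD.
by rewrite !subquot_piZ scalerDr raddfD.
Qed.

Fact subquot_scaleDl x : {morph subquot_scale^~ x : a b / a + b}.
Proof. by move=> a b; rewrite /subquot_scale scalerDl raddfD. Qed.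

HB.instance Definition _ := GRing.Zmodule_isLmodule.Build K subquot
  subquot_scaleA subquot_scale1 subquot_scaleDr subquot_scaleDl.

End SubQuotient.

Record lie_algebra (K : fieldType) (g : lmodType K) (br : g -> g -> g)
    : Prop := {
  lie_linear_l : forall y, linear (br^~ y);
  lie_linear_r : forall x, linear (br x);
  lie_alternating : forall x, br x x = 0;
  lie_jacobi : forall x y z, br x (br y z) + br y (br z x) + br z (br x y) = 0
}.

Section Primary.
Variables (K : fieldType) (V : lmodType K) (Y : V -> int -> {linear V -> V}).
Variables om tp tm jj : V.

(* [Gplus n] and [Gminus n] are [G^+_(n+1/2)] and [G^-_(n+1/2)]. *)
Definition Lop (n : int) := Y om (n + 1).
Definition Gplus (n : int) := Y tp (n + 1).
Definition Gminus (n : int) := Y tm (n + 1).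
Definition Jop (n : int) := Y jj n.

Definition Vrs (r s : K) (v : V) : Prop := Lop 0 v = r *: v /\ Jop 0 v = s *: v.

Definition Pij (r s : K) : {pred V} := [pred v |
  `[< [/\ Vrs r s v,
          forall n : int, (0 < n)%R -> Gplus (n - 1) v = 0,
          forall n : int, (0 < n)%R -> Gminus (n - 1) v = 0 &
          forall n : int, (0 < n)%R -> Jop n v = 0] >]].

(* [G^+_(-1/2) V_(-1/2,-1) + G^-_(-1/2) V_(-1/2,1)] *)
Definition Gimage : {pred V} := [pred v |
  `[< exists x y, [/\ Vrs (- 2^-1) (- 1) x, Vrs (- 2^-1) 1 y &
                      v = Gplus (- 1) x + Gminus (- 1) y] >]].

Lemma Vrs_submod r s a u v : Vrs r s u -> Vrs r s v -> Vrs r s (a *: u + v).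
Proof.
move=> [Lu Ju] [Lv Jv]; split; rewrite [LHS]linearP.
  by rewrite Lu Lv scalerDr !scalerA mulrC.
by rewrite Ju Jv scalerDr !scalerA mulrC.
Qed.

Lemma Vrs0 r s : Vrs r s 0.
Proof. by split; rewrite linear0 scaler0. Qed.

Fact Pij_submod r s : submod_closed (Pij r s).
Proof.
split=> [|a u v]; rewrite !unfold_in.
  by apply/asboolP; split=> [|n _|n _|n _]; rewrite ?linear0 //; apply: Vrs0.
move=> /asboolP[Vu Pu Mu Ju] /asboolP[Vv Pv Mv Jv]; apply/asboolP.
split=> [|n n0|n n0|n n0]; first exact: Vrs_submod.
- by rewrite linearP Pu // Pv // scaler0 addr0.
- by rewrite linearP Mu // Mv // scaler0 addr0.
- by rewrite linearP Ju // Jv // scaler0 addr0.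
Qed.
HB.instance Definition _ r s :=
  GRing.isSubmodClosed.Build K V (Pij r s) (Pij_submod r s).

Fact Gimage_submod : submod_closed Gimage.
Proof.
split=> [|a u v]; rewrite !unfold_in.
  apply/asboolP; exists 0, 0; rewrite !linear0 addr0.
  by split=> //; apply: Vrs0.
move=> /asboolP[x [y [Vx Vy ->]]] /asboolP[x' [y' [Vx' Vy' ->]]].
apply/asboolP; exists (a *: x + x'), (a *: y + y').
split; [exact: Vrs_submod|exact: Vrs_submod|].
by rewrite !linearP scalerDr addrACA.
Qed.
HB.instance Definition _ :=
  GRing.isSubmodClosed.Build K V Gimage Gimage_submod.

Definition P00 : lmodType K := submod_of (Pij 0 0).
Definition Ptilde : lmodType K := subquot (Pij 0 0) Gimage.
Definition Ppi : P00 -> Ptilde := subquot_pi Gimage (P := Pij 0 0).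

(* [Res_z Y(G^+_(-1/2) G^-_(-1/2) u, z) v] *)
Definition bracket (u v : V) : V := Y (Gplus (- 1) (Gminus (- 1) u)) 0 v.

End Primary.

(* Main.v *)
Require Import Defs.
From mathcomp Require Import all_boot all_order all_algebra finmap.
From mathcomp Require Import ring zify.
From mathcomp Require Import complex boolp reals.
From mathcomp.multinomials Require Import monalg.

Set Implicit Arguments.
Unset Strict Implicit.
Unset Printing Implicit Defensive.

Import Order.TTheory GRing.Theory Num.Theory.
Local Open Scope ring_scope.

(** Write G^±, L, J for the modes of tau^±, omega, j, write T for the
    translation operator, and put u^ = G^+_{-1/2} G^-_{-1/2} u, so that the
    bracket of u and v is u^_(0) v. Everything follows from the commutator
    formula [u_(m), v_(n)] = sum_k binom(m, k) (u_(k) v)_(m+n-k) and from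
    skew-symmetry, both of which are instances of the Borcherds identity.

    For u in P^{0,0}, the singular products of tau^+ with u^ all vanish, and
    the only nonzero singular products of tau^- with u^ are
    G^-_{-1/2} u^ = T x and G^-_{1/2} u^ = x, where x = G^-_{-1/2} u; their
    contributions to the commutator cancel. Hence u^_(0) commutes with all the
    modes of tau^±, and therefore with all J_n and with L_0, which are
    combinations of anticommutators of these ([tp_ggu0_comm],
    [tm_ggu0_comm]). So the bracket with u preserves P^{0,0} and the image of
    G^±_{-1/2} that is divided out.
    - If u is itself in that image, then u^ is a translate Ty, and
      (Ty)_(0) = 0: the bracket is zero ([bracket_Gimage]).
    - Since u^_(0) commutes with G^±_{-1/2} and is a derivation of all the
      products, (u^_(0) v)^ = u^_(0) v^, which is the Leibniz form of the
      Jacobi identity ([bracket_leibniz]).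
    - Moving G^+_{-1/2} and G^-_{-1/2} from u to v gives
      u^_(0) v = u_(0) v^ modulo the image, and u_(0) v^ = - v^_(0) u modulo
      translates by skew-symmetry; translates T w = (G^+_{-1/2} G^-_{-1/2}
      + G^-_{-1/2} G^+_{-1/2}) w of the relevant w lie in the image
      ([bracket_anticomm]).

    The signs in this argument suppose that the vectors of P^{0,0} are even.
    This holds because J_0 counts the fermions a minus the fermions a^*, so
    that charge zero forces an even number of fermions ([fock_charge]).

    It remains to find the N = 2 relations in the Fock space. The elements
    h_i^± and a_i, a_i^* are free fields: their singular products are
    multiples of the vacuum. The products of tau^±, omega and j follow
    ([free_superconformal]), except that L_{-1} = T has to be checked on the
    whole space: both sides are derivations, they agree on the free fields,
    and they agree on each e^lam because the explicit vertex operator gives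
    T e^lam = lam(-1) e^lam, while omega_(0) e^lam is the expansion of
    lam(-1) e^lam along the dual bases h_i^± ([fock_omega0]). *)

(** * Formal sums and generalized binomial coefficients *)

Lemma sums_to_trunc (V : zmodType) (f : nat -> V) s n :
  sums_to f s -> (forall j, (n <= j)%N -> f j = 0) -> s = \sum_(j < n) f j.
Proof.
move=> [N0 sumf] f0; rewrite -(sumf (maxn n N0)) ?leq_maxr //.
rewrite -!(big_mkord xpredT f) (big_cat_nat (n := n)) ?leq_maxl //=.
rewrite [X in _ + X]big_nat [X in _ + X]big1 ?addr0 // => j /andP[nj _].
exact: f0.
Qed.

Section Binomial.
Variable K : numFieldType.

Lemma binz0 m : binz K m 0 = 1.
Proof. by rewrite /binz big_ord0 fact0 divr1. Qed.

Lemma binz1 m : binz K m 1 = m%:~R.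
Proof. by rewrite /binz big_ord1 subr0 factS fact0 divr1. Qed.

Lemma binz_small (m j : nat) : (m < j)%N -> binz K m j = 0.
Proof.
by move=> mj; rewrite /binz (bigD1 (Ordinal mj)) //= subrr !mul0r.
Qed.

End Binomial.

(** * Consequences of the Borcherds identity *)

Section VertexSuperalgebra.
Variables (K : numFieldType) (V : lmodType K) (par : bool -> {pred V}).
Variables (vac : V) (Y : V -> int -> {linear V -> V}).
Hypothesis vaY : vertex_superalgebra par vac Y.
Hypothesis par_submod : forall p, submod_closed (par p).
Hypothesis par_split : forall v,
  exists2 v0, v0 \in par false & exists2 v1, v1 \in par true & v = v0 + v1.

(** The translation operator. *)
Definition transl (u : V) : V := Y u (- 2) vac.

Lemma YP n w a u v : Y (a *: u + v) n w = a *: Y u n w + Y v n w.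
Proof. exact: (va_linear vaY). Qed.

Lemma Y0l n w : Y 0 n w = 0.
Proof. by have := YP n w (-1) 0 0; rewrite scaler0 addr0 scaleN1r addNr. Qed.

Lemma YD n w u v : Y (u + v) n w = Y u n w + Y v n w.
Proof. by have := YP n w 1 u v; rewrite !scale1r. Qed.

Lemma YZ n w a u : Y (a *: u) n w = a *: Y u n w.
Proof. by have := YP n w a u 0; rewrite !addr0 Y0l addr0. Qed.

Lemma YN n w u : Y (- u) n w = - Y u n w.
Proof. by rewrite -scaleN1r YZ scaleN1r. Qed.

Lemma Ysum n w (I : Type) (r : seq I) (P : pred I) (F : I -> V) :
  Y (\sum_(i <- r | P i) F i) n w = \sum_(i <- r | P i) Y (F i) n w.
Proof. by apply: (big_morph (fun u => Y u n w) (YD n w) (Y0l n w)). Qed.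

Lemma parD p u v : u \in par p -> v \in par p -> u + v \in par p.
Proof.
by case: (par_submod p) => _ par_lin pu pv; rewrite -[u]scale1r par_lin.
Qed.

Lemma parZ p a u : u \in par p -> a *: u \in par p.
Proof.
by case: (par_submod p) => par0 par_lin pu; rewrite -[_ *: _]addr0 par_lin.
Qed.

Lemma par_sum p (I : Type) (r : seq I) (P : pred I) (F : I -> V) :
  (forall i, P i -> F i \in par p) -> \sum_(i <- r | P i) F i \in par p.
Proof.
move=> parF; apply: (big_ind (fun u => u \in par p)) => //.
- by case: (par_submod p).
- by move=> u v; apply: parD.
Qed.

(** The commutator formula is the case [k = 0] of the Borcherds identity. *)
Lemma commutator p q u v m n w N : u \in par p -> v \in par q ->
    (forall j, (N <= j)%N ->
      binz K m j *: Y (Y u j%:Z v) (m + n - j%:Z) w = 0) ->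
  Y u m (Y v n w) - (-1) ^+ (p && q) *: Y v n (Y u m w)
  = \sum_(j < N) binz K m j *: Y (Y u j%:Z v) (m + n - j%:Z) w.
Proof.
move=> pu qv trunc.
have [s suml sumr] := va_borcherds vaY w 0 m n pu qv.
have -> : \sum_(j < N) binz K m j *: Y (Y u j%:Z v) (m + n - j%:Z) w = s.
  apply/esym; rewrite (sums_to_trunc suml (n := N)) => [|j /trunc].
    by apply: eq_bigr => j _; rewrite add0r.
  by rewrite add0r.
rewrite (sums_to_trunc sumr (n := 1)) => [|j j1]; last first.
  by rewrite (@binz_small _ 0) // mulr0 scale0r.
by rewrite big_ord1 /= binz0 mulr1 scale1r !addr0 expr0z mulr1.
Qed.

(** The modes of an [n]-th product are the case [m = 0]. *)
Lemma iterate p q u v k n w N : u \in par p -> v \in par q ->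
    (forall j, (N <= j)%N -> Y v (n + j%:Z) w = 0) ->
    (forall j, (N <= j)%N -> Y u j%:Z w = 0) ->
  Y (Y u k v) n w = \sum_(j < N) ((-1) ^+ j * binz K k j) *:
    (Y u (k - j%:Z) (Y v (n + j%:Z) w)
     - ((-1) ^+ (p && q) * (-1) ^ k) *: Y v (n + k - j%:Z) (Y u j%:Z w)).
Proof.
move=> pu qv truncv truncu.
have [s suml sumr] := va_borcherds vaY w k 0 n pu qv.
have -> : Y (Y u k v) n w = s.
  rewrite (sums_to_trunc suml (n := 1)) => [|j j1]; last first.
    by rewrite (@binz_small _ 0) // scale0r.
  by rewrite big_ord1 /= binz0 scale1r addr0 add0r subr0.
rewrite (sums_to_trunc sumr (n := N)) => [|j Nj].
  by apply: eq_bigr => j _; rewrite !add0r.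
by rewrite !add0r truncv // truncu // !(linear0, subr0).
Qed.

(** The case [m = 0] of the commutator formula: zeroth modes are derivations. *)
Lemma Y0_derivation p q u v n w : u \in par p -> v \in par q ->
  Y u 0 (Y v n w) = Y (Y u 0 v) n w + (-1) ^+ (p && q) *: Y v n (Y u 0 w).
Proof.
move=> pu pv; have := @commutator p q u v 0 n w 1 pu pv.
rewrite big_ord1 /= binz0 scale1r add0r addr0 => <-; first by rewrite subrK.
by move=> j j1; rewrite (@binz_small _ 0) // scale0r.
Qed.

(** For a natural number [m] the coefficients vanish beyond [m], and no sign
    depends on the parity of [v]; linearity then covers all [v]. *)
Lemma even_commutator u v (m : nat) n w : u \in par false ->
  Y u m (Y v n w) = Y v n (Y u m w)
    + \sum_(j < m.+1) binz K m j *: Y (Y u j%:Z v) (m%:Z + n - j%:Z) w.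
Proof.
move=> pu; have [v0 pv0 [v1 pv1 ->]] := par_split v.
suff hom q x : x \in par q -> Y u m (Y x n w) = Y x n (Y u m w)
    + \sum_(j < m.+1) binz K m j *: Y (Y u j%:Z x) (m%:Z + n - j%:Z) w.
  rewrite !YD !linearD /= (hom _ _ pv0) (hom _ _ pv1) addrACA -big_split /=.
  by congr (_ + _); apply: eq_bigr => j _; rewrite linearD YD scalerDr.
move=> px; rewrite -(@commutator false q) //; last first.
  by move=> j mj; rewrite binz_small // scale0r.
by rewrite scale1r addrC subrK.
Qed.

Lemma even_derivation u v n w : u \in par false ->
  Y u 0 (Y v n w) = Y v n (Y u 0 w) + Y (Y u 0 v) n w.
Proof.
by move=> pu; rewrite even_commutator // big_ord1 binz0 scale1r add0r addr0.
Qed.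

Lemma vac_even : vac \in par false. Proof. exact: (va_vac_even vaY). Qed.

Lemma par_Y p q u v n : u \in par p -> v \in par q -> Y u n v \in par (p (+) q).
Proof. exact: (va_parity vaY). Qed.

Lemma Yvac (n : int) v : n != -1 -> Y vac n v = 0.
Proof. by rewrite (va_vacuum vaY) => /negbTE->. Qed.

Lemma Y_vac_ge0 u (n : int) : 0 <= n -> Y u n vac = 0.
Proof. exact: (va_creation0 vaY). Qed.

Lemma transl_is_linear : linear transl.
Proof. by move=> a u v; rewrite /transl YP. Qed.

(** In the Borcherds identity with [v = vac], [k = -2] and [n = 0] the modes
    of the vacuum annihilate the right-hand side, and the left-hand side has
    only two terms. *)
Lemma Y_transl u n w : Y (transl u) n w = - (n%:~R *: Y u (n - 1) w).
Proof.
have [u0 pu0 [u1 pu1 ->]] := par_split u.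
suff hom p x : x \in par p ->
    Y (transl x) n w = - (n%:~R *: Y x (n - 1) w).
  by rewrite /transl !YD (hom _ _ pu0) (hom _ _ pu1) scalerDr opprD.
move=> px; have [s suml sumr] := va_borcherds vaY w (- 2) n 0 px vac_even.
have s0 : s = 0.
  rewrite (sums_to_trunc sumr (n := 0)) ?big_ord0 // => j _.
  by rewrite !Yvac ?(linear0, subr0) //; lia.
apply/eqP; rewrite -addr_eq0 -[X in _ == X]s0; apply/eqP.
rewrite (sums_to_trunc suml (n := 2)) => [|j j2]; last first.
  by rewrite Y_vac_ge0 ?Y0l ?scaler0 //; lia.
rewrite big_ord_recr big_ord1 /= binz0 binz1 scale1r !addr0.
by rewrite (_ : - 2 + 1 = -1) ?(va_creation vaY) //; lia.
Qed.

(** The case [m = 0], [n = -2], [w = vac] of the Borcherds identity. *)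
Lemma transl_Y u n v : transl (Y u n v) = Y u n (transl v) + Y (transl u) n v.
Proof.
have [u0 pu0 [u1 pu1 ->]] := par_split u.
have [v0 pv0 [v1 pv1 ->]] := par_split v.
suff hom p q x y : x \in par p -> y \in par q ->
    transl (Y x n y) = Y x n (transl y) + Y (transl x) n y.
  rewrite /transl !linearD /= !YD !linearD /= ?YD.
  rewrite -!/(transl _) (hom _ _ _ _ pu0 pv0) (hom _ _ _ _ pu0 pv1).
  rewrite (hom _ _ _ _ pu1 pv0) (hom _ _ _ _ pu1 pv1).
  by rewrite [LHS](AC ((2*2)*(2*2)) (((1*5)*(3*7))*((2*4)*(6*8)))).
move=> px py; rewrite /transl (@iterate p q _ _ _ _ _ 2) //.
- rewrite big_ord_recr big_ord1 /= !binz0 !binz1.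
  rewrite [Y x 0%:Z _]Y_vac_ge0 // [Y x 1%:Z _]Y_vac_ge0 //.
  rewrite !(linear0, subr0) -/(transl y).
  rewrite -/(transl x) Y_transl mulr1 expr0 scale1r.
  by rewrite (va_creation vaY) expr1 mulN1r scaleNr.
- by move=> j j2; rewrite Y_vac_ge0 //; lia.
- by move=> j _; rewrite Y_vac_ge0.
Qed.

(** The case [k = 0], [m = -1], [n = 0], [w = vac] of the Borcherds identity:
    up to terms [x_(-2-j) vac], the products [u_(0) v] and [v_(0) u] are
    opposite to each other. *)
Lemma skew_symmetry u v : u \in par false -> v \in par false ->
  exists N, Y v 0 u = - (\sum_(j < N.+1) binz K (-1) j *:
                         Y (Y u j%:Z v) (- 1 - j%:Z) vac).
Proof.
move=> pu pv; have [N truncN] := va_truncation vaY u v.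
have [s suml sumr] := va_borcherds vaY vac 0 (-1) 0 pu pv.
exists `|N|%N; apply/eqP; rewrite -subr_eq0 opprK; apply/eqP.
have -> : \sum_(j < `|N|%N.+1) binz K (-1) j *: Y (Y u j%:Z v) (- 1 - j%:Z) vac
    = s.
  rewrite (sums_to_trunc suml (n := `|N|%N.+1)) => [|j Nj].
    by apply: eq_bigr => j _; rewrite add0r addr0.
  by rewrite truncN ?Y0l ?scaler0 //; lia.
rewrite (sums_to_trunc sumr (n := 1)) => [|j j1]; last first.
  by rewrite (@binz_small _ 0) // mulr0 scale0r.
rewrite big_ord1 /= binz0 !addr0 [Y v _ vac]Y_vac_ge0 // linear0 expr0z.
by rewrite (va_creation vaY) expr0 !mul1r !scale1r sub0r addrN.
Qed.

End VertexSuperalgebra.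

(** * The N = 2 superconformal algebra *)

(** The operator products of the N = 2 algebra of central charge [3 c]. Those
    of [om] with [tp] and [tm] are consequences, see [om1_tm0]. The last two
    fields are [L_(-1) = T] and the fact that charge zero implies even. *)
Record superconformal (K : numFieldType) (V : lmodType K)
    (par : bool -> {pred V}) (vac : V) (Y : V -> int -> {linear V -> V})
    (om tp tm jj : V) (c : K) : Prop := {
  tp_odd : tp \in par true;
  tm_odd : tm \in par true;
  tp_tp : forall k : nat, Y tp k tp = 0;
  tm_tm : forall k : nat, Y tm k tm = 0;
  tp0_tm : Y tp 0 tm = om + 2^-1 *: transl vac Y jj;
  tp1_tm : Y tp 1 tm = jj;
  tp2_tm : Y tp 2 tm = c *: vac;
  tp_tm : forall k : nat, (2 < k)%N -> Y tp k tm = 0;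
  jj0_tp : Y jj 0 tp = tp;
  jj0_tm : Y jj 0 tm = - tm;
  jj_tp : forall k : nat, (0 < k)%N -> Y jj k tp = 0;
  jj_tm : forall k : nat, (0 < k)%N -> Y jj k tm = 0;
  om0_transl : forall x, Y om 0 x = transl vac Y x;
  charge0_even : forall x, Y jj 0 x = 0 -> x \in par false
}.

Section Superconformal.
Variables (K : numFieldType) (V : lmodType K) (par : bool -> {pred V}).
Variables (vac : V) (Y : V -> int -> {linear V -> V}).
Hypothesis vaY : vertex_superalgebra par vac Y.
Hypothesis par_submod : forall p, submod_closed (par p).
Hypothesis par_split : forall v,
  exists2 v0, v0 \in par false & exists2 v1, v1 \in par true & v = v0 + v1.
Variables (om tp tm jj : V) (c : K).
Hypothesis scY : superconformal par vac Y om tp tm jj c.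

Local Notation T := (transl vac Y).
Local Notation Vrs := (Vrs Y om jj).
Local Notation Pij := (Pij Y om tp tm jj).
Local Notation Gimage := (Gimage Y om tp tm jj).
Local Notation bracket := (bracket Y tp tm).

Let tpo := tp_odd scY.
Let tmo := tm_odd scY.

Lemma jj_even : jj \in par false.
Proof. by rewrite -(tp1_tm scY) (par_Y vaY _ tpo tmo). Qed.

Lemma om_even : om \in par false.
Proof.
have -> : om = Y tp 0 tm + - 2^-1 *: T jj.
  by rewrite (tp0_tm scY) scaleNr addrK.
apply: (parD par_submod); first exact: (par_Y vaY _ tpo tmo).
apply: (parZ par_submod); exact: (par_Y vaY _ jj_even (vac_even vaY)).
Qed.

Lemma tp_anticomm a b x : Y tp a (Y tp b x) = - Y tp b (Y tp a x).
Proof.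
have := @commutator _ _ _ _ _ vaY true true tp tp a b x 0 tpo tpo.
rewrite big_ord0 expr1 scaleN1r opprK => tt0; apply/eqP; rewrite -addr_eq0.
by apply/eqP/tt0 => j _; rewrite (tp_tp scY) (Y0l vaY) scaler0.
Qed.

Lemma tm_anticomm a b x : Y tm a (Y tm b x) = - Y tm b (Y tm a x).
Proof.
have := @commutator _ _ _ _ _ vaY true true tm tm a b x 0 tmo tmo.
rewrite big_ord0 expr1 scaleN1r opprK => tt0; apply/eqP; rewrite -addr_eq0.
by apply/eqP/tt0 => j _; rewrite (tm_tm scY) (Y0l vaY) scaler0.
Qed.

Lemma eq_opp0 (x : V) : x = - x -> x = 0.
Proof.
move/eqP; rewrite -addr_eq0 -mulr2n -scaler_nat scaler_eq0.
by rewrite pnatr_eq0 => /eqP.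
Qed.

Lemma tp_sqr0 x : Y tp 0 (Y tp 0 x) = 0.
Proof. exact/eq_opp0/tp_anticomm. Qed.

Lemma tm_sqr0 x : Y tm 0 (Y tm 0 x) = 0.
Proof. exact/eq_opp0/tm_anticomm. Qed.

(** [{G^+_r, G^-_s} = L_(r+s) + 1/2 (r - s) J_(r+s) + central term], where
    [r = a - 1/2] and [s = b - 1/2]. *)
Lemma tp_tm_anticomm a b x :
  Y tp a (Y tm b x) + Y tm b (Y tp a x)
  = Y om (a + b) x + (2^-1 * (a - b)%:~R) *: Y jj (a + b - 1) x
    + (binz K a 2 * c) *: Y vac (a + b - 2) x.
Proof.
have := @commutator _ _ _ _ _ vaY true true tp tm a b x 3 tpo tmo.
rewrite expr1 scaleN1r opprK => -> => [|j j3]; last first.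
  by rewrite (tp_tm scY) // (Y0l vaY) scaler0.
rewrite !big_ord_recr big_ord0 /= add0r binz0 binz1 scale1r subr0.
rewrite (tp0_tm scY) (tp1_tm scY) (tp2_tm scY) (YD vaY) !(YZ vaY).
rewrite (Y_transl vaY par_split) scalerA; congr (_ + _).
rewrite -addrA; congr (_ + _); rewrite scalerN -scaleNr scalerA -scalerDl.
by congr (_ *: _); rewrite !rmorphD /= rmorphN; field.
Qed.

Lemma jj_tm_comm a b x : Y jj a (Y tm b x) = Y tm b (Y jj a x) - Y tm (a + b) x.
Proof.
have := @commutator _ _ _ _ _ vaY false true jj tm a b x 1 jj_even tmo.
rewrite expr0 scale1r => tt; apply/eqP; rewrite addrC -subr_eq.
rewrite {}tt => [|j j1]; last by rewrite (jj_tm scY) // (Y0l vaY) scaler0.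
by rewrite big_ord1 binz0 scale1r (jj0_tm scY) (YN vaY) subr0.
Qed.

Lemma jj_tp_comm a b x : Y jj a (Y tp b x) = Y tp b (Y jj a x) + Y tp (a + b) x.
Proof.
have := @commutator _ _ _ _ _ vaY false true jj tp a b x 1 jj_even tpo.
rewrite expr0 scale1r => tt; apply/eqP; rewrite addrC -subr_eq.
rewrite {}tt => [|j j1]; last by rewrite (jj_tp scY) // (Y0l vaY) scaler0.
by rewrite big_ord1 binz0 scale1r (jj0_tp scY) subr0.
Qed.

(** In [tp_tm_anticomm] the coefficient of [J] depends on the splitting of
    the total index, so that [J_n] and [L_0] are combinations of
    anticommutators. *)
Lemma jj_from_tau n x : Y jj n x =
  Y tp 1 (Y tm n x) + Y tm n (Y tp 1 x)
  - (Y tp 0 (Y tm (n + 1) x) + Y tm (n + 1) (Y tp 0 x)).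
Proof.
rewrite !tp_tm_anticomm !binz_small // !mul0r !scale0r !addr0.
rewrite add0r [1 + n]addrC addrK [RHS]addrC opprD -addrA addrCA addrA.
rewrite addrA subrK -scaleNr -scalerDl -[LHS]scale1r; congr (_ *: _).
by rewrite !rmorphD /= !rmorphN /= rmorphD /=; field.
Qed.

Lemma om1_from_tau_m x :
  Y om 1 x = Y tp 1 (Y tm 0 x) + Y tm 0 (Y tp 1 x) - 2^-1 *: Y jj 0 x.
Proof.
rewrite tp_tm_anticomm binz_small // mul0r scale0r addr0.
by rewrite subr0 mulr1 addrK.
Qed.

Lemma om1_from_tau_p x :
  Y om 1 x = Y tp 0 (Y tm 1 x) + Y tm 1 (Y tp 0 x) + 2^-1 *: Y jj 0 x.
Proof.
rewrite tp_tm_anticomm binz_small // mul0r scale0r addr0.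
by rewrite sub0r mulrN mulr1 scaleNr subrK.
Qed.

Lemma transl_from_tau x : T x = Y tp 0 (Y tm 0 x) + Y tm 0 (Y tp 0 x).
Proof.
rewrite tp_tm_anticomm binz_small // mul0r scale0r addr0 subr0 mulr0 scale0r.
by rewrite addr0 (om0_transl scY).
Qed.

(** [L_0] is [{G^+_(1/2), G^-_(-1/2)} - 1/2 J_0], and the anticommutator
    commutes with [G^-_(-1/2)], whose square is zero. Only [J_0] contributes. *)
Lemma om1_tm0 x : Y om 1 (Y tm 0 x) = Y tm 0 (Y om 1 x) + 2^-1 *: Y tm 0 x.
Proof.
rewrite !om1_from_tau_m jj_tm_comm tm_sqr0 linear0 add0r addr0.
rewrite [in RHS]linearB [in RHS]linearD /= tm_sqr0 addr0 scalerBr opprB.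
rewrite [Y tm 0 (_ *: _)]linearZ /= -[RHS]addrA; congr (_ + _).
by rewrite addrC.
Qed.

Lemma om1_tp0 x : Y om 1 (Y tp 0 x) = Y tp 0 (Y om 1 x) + 2^-1 *: Y tp 0 x.
Proof.
rewrite !om1_from_tau_p jj_tp_comm tp_sqr0 linear0 add0r addr0.
rewrite [in RHS]linearD [in RHS]linearD [Y tp 0 (_ *: _)]linearZ /=.
by rewrite tp_sqr0 add0r scalerDr addrA.
Qed.

(** * Weights and charges *)

Lemma VrsE r s x : Vrs r s x <-> Y om 1 x = r *: x /\ Y jj 0 x = s *: x.
Proof. by []. Qed.

Lemma Vrs_Y r s r' s' x y (n : int) : Vrs r s x -> Vrs r' s' y ->
  Vrs (r + r' - n%:~R - 1) (s + s') (Y x n y).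
Proof.
move=> /VrsE[Lx Jx] /VrsE[Ly Jy]; apply/VrsE; split.
  rewrite (even_commutator vaY par_split x 1) ?om_even //.
  rewrite big_ord_recr big_ord1 /= binz0 binz1 !scale1r Lx Ly.
  rewrite (om0_transl scY) (Y_transl vaY par_split) (YZ vaY) subr0.
  rewrite linearZ /= (_ : 1 + n - 1 = n) -?scaleNr -?scalerDl; last by lia.
  by congr (_ *: _); rewrite rmorphD /=; ring.
rewrite (even_derivation vaY par_split) ?jj_even // Jx Jy linearZ /= (YZ vaY).
by rewrite -scalerDl addrC.
Qed.

Lemma Vrs_vac : Vrs 0 0 vac.
Proof. by apply/VrsE; rewrite !(Y_vac_ge0 vaY) // !scale0r. Qed.

Lemma Vrs_tp0 r s x : Vrs r s x -> Vrs (r + 2^-1) (s + 1) (Y tp 0 x).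
Proof.
move=> /VrsE[Lx Jx]; apply/VrsE; rewrite om1_tp0 jj_tp_comm Lx Jx addr0.
by rewrite !linearZ /= !scalerDl scale1r.
Qed.

Lemma Vrs_tm0 r s x : Vrs r s x -> Vrs (r + 2^-1) (s - 1) (Y tm 0 x).
Proof.
move=> /VrsE[Lx Jx]; apply/VrsE; rewrite om1_tm0 jj_tm_comm Lx Jx addr0.
by rewrite !linearZ /= scalerBl scalerDl scale1r.
Qed.

Lemma GimageP x : reflect (exists y z, [/\ Vrs (- 2^-1) (- 1) y,
  Vrs (- 2^-1) 1 z & x = Y tp 0 y + Y tm 0 z]) (x \in Gimage).
Proof. exact: asboolP. Qed.

Lemma Gimage_tp y : Vrs (- 2^-1) (- 1) y -> Y tp 0 y \in Gimage.
Proof.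
move=> Vy; apply/GimageP; exists y, 0; split=> //; first exact: Vrs0.
by rewrite linear0 addr0.
Qed.

Lemma Gimage_tm y : Vrs (- 2^-1) 1 y -> Y tm 0 y \in Gimage.
Proof.
move=> Vy; apply/GimageP; exists 0, y; split=> //; first exact: Vrs0.
by rewrite linear0 add0r.
Qed.

(** [T x = G^+_(-1/2) (G^-_(-1/2) x) + G^-_(-1/2) (G^+_(-1/2) x)]. *)
Lemma Gimage_transl x : Vrs (- 1) 0 x -> T x \in Gimage.
Proof.
move=> Vx; rewrite transl_from_tau rpredD ?Gimage_tp ?Gimage_tm //.
  by have := Vrs_tm0 Vx; congr Vrs; field.
by have := Vrs_tp0 Vx; congr Vrs; field.
Qed.

(** * Primary vectors *)

Lemma PijP r s x : reflect [/\ Vrs r s x, forall n : int, 0 < n -> Y tp n x = 0,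
  forall n : int, 0 < n -> Y tm n x = 0 & forall n : int, 0 < n -> Y jj n x = 0]
  (x \in Pij r s).
Proof.
apply: (iffP (asboolP _)) => -[Vx Px Mx Jx]; split=> // n n0.
- by have := Px n n0; rewrite /Gplus subrK.
- by have := Mx n n0; rewrite /Gminus subrK.
- by rewrite /Gplus subrK Px.
- by rewrite /Gminus subrK Mx.
Qed.

Lemma bracketE u v : bracket u v = Y (Y tp 0 (Y tm 0 u)) 0 v.
Proof. by []. Qed.

(** If [u = G^+_(-1/2) y + G^-_(-1/2) z], then [(G^-_(-1/2))^2 = 0] gives
    [G^+_(-1/2) G^-_(-1/2) u = T (G^+_(-1/2) y)], and the zeroth mode
    of a translate vanishes. *)
Lemma bracket_Gimage u v : u \in Gimage -> bracket u v = 0.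
Proof.
case/GimageP => y [z [_ _ uE]]; rewrite bracketE uE linearD /= tm_sqr0.
have -> : Y tp 0 (Y tm 0 (Y tp 0 y) + 0) = T (Y tp 0 y).
  by rewrite transl_from_tau tp_sqr0 linear0 !addr0.
by rewrite (Y_transl vaY par_split) scale0r oppr0.
Qed.

Section Primary.
Variable u : V.
Hypothesis Pu : u \in Pij 0 0.

(* [gu] and [ggu] are [G^-_(-1/2) u] and [G^+_(-1/2) G^-_(-1/2) u]. *)
Let gu := Y tm 0 u.
Let ggu := Y tp 0 gu.

Lemma primary_jj (n : nat) : Y jj n u = 0.
Proof.
case/PijP: Pu => /VrsE[_ Ju] _ _ Jpos; case: n => [|n]; last exact: Jpos.
by rewrite Ju scale0r.
Qed.

Lemma primary_even : u \in par false.
Proof. exact/(charge0_even scY)/(primary_jj 0). Qed.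

(** [L_n] with [n > 0] is an anticommutator of [G^+_(n-1/2)] and
    [G^-_(1/2)], up to [J_n] and a central term that vanishes on [u]. *)
Lemma primary_om (n : nat) : Y om n.+1 u = 0.
Proof.
case/PijP: Pu => /VrsE[Lu _] tpu tmu _.
case: n => [|n]; first by rewrite Lu scale0r.
have := tp_tm_anticomm n.+1%:Z 1 u.
rewrite tpu // tmu // !linear0 addr0 (_ : n.+1%:Z + 1 - 1 = n.+1); last by lia.
rewrite primary_jj scaler0 addr0 (Yvac vaY) ?scaler0 ?addr0; last by lia.
by rewrite (_ : n.+1%:Z + 1 = n.+2) //; lia.
Qed.

Lemma gu_odd : gu \in par true.
Proof. exact: (par_Y vaY _ tmo primary_even). Qed.

Lemma ggu_even : ggu \in par false.
Proof. exact: (par_Y vaY _ tpo gu_odd). Qed.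

Lemma tp_gu (n : nat) : Y tp n.+1 gu = 0.
Proof.
case/PijP: Pu => _ tpu _ _.
have := tp_tm_anticomm n.+1%:Z 0 u.
rewrite tpu // linear0 !addr0 primary_om add0r.
rewrite (_ : n.+1%:Z - 1 = n); last by lia.
rewrite primary_jj scaler0 add0r -/gu => ->.
case: n => [|n]; first by rewrite binz_small // mul0r scale0r.
by rewrite (Yvac vaY) ?scaler0 //; lia.
Qed.

Lemma tm_gu (n : nat) : Y tm n gu = 0.
Proof.
case/PijP: Pu => _ _ tmu _; case: n => [|n]; first exact: tm_sqr0.
by rewrite /gu tm_anticomm tmu // linear0 oppr0.
Qed.

Lemma tp_ggu (n : nat) : Y tp n ggu = 0.
Proof.
case: n => [|n]; first exact: tp_sqr0.
by rewrite /ggu tp_anticomm tp_gu linear0 oppr0.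
Qed.

Lemma jj0_gu : Y jj 0 gu = - gu.
Proof. by rewrite /gu jj_tm_comm primary_jj linear0 sub0r addr0. Qed.

Lemma jj_gu (n : nat) : Y jj n.+1 gu = 0.
Proof.
case/PijP: Pu => _ _ tmu _.
by rewrite /gu jj_tm_comm primary_jj linear0 sub0r addr0 tmu ?oppr0.
Qed.

(** [L_n + 1/2 (n + 1) J_n] is [{G^+_(n+1/2), G^-_(-1/2)}] up to a central
    term, and both factors annihilate [gu]. *)
Lemma om_gu (n : nat) : Y om n.+1 gu = - (2^-1 * n.+1%:R) *: Y jj n gu.
Proof.
have := tp_tm_anticomm n.+1%:Z 0 gu; rewrite tp_gu -/gu tm_gu !linear0 !addr0.
rewrite (_ : n.+1%:Z - 1 = n); last by lia.
move/esym/eqP; rewrite -addrA addr_eq0 => /eqP->.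
rewrite scaleNr; congr (- _); rewrite -[RHS]addr0; congr (_ + _).
case: n => [|n]; first by rewrite binz_small // mul0r scale0r.
by rewrite (Yvac vaY) ?scaler0 //; lia.
Qed.

Lemma tm0_ggu : Y tm 0 ggu = T gu.
Proof. by rewrite transl_from_tau tm_gu linear0 add0r. Qed.

Lemma tm_succ_ggu (n : nat) : Y tm n.+1 ggu = - n.+1%:R *: Y jj n gu.
Proof.
have := tp_tm_anticomm 0 n.+1%:Z gu.
rewrite tm_gu linear0 add0r -/ggu => ->.
rewrite binz_small // mul0r scale0r addr0 !add0r om_gu.
rewrite (_ : n.+1%:Z - 1 = n) -?scalerDl; last by lia.
by congr (_ *: _); rewrite rmorphN /= mulrN -opprD; congr (- _); field.
Qed.

Lemma tp_ggu0_comm m w : Y tp m (Y ggu 0 w) = Y ggu 0 (Y tp m w).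
Proof.
have := @commutator _ _ _ _ _ vaY true false tp ggu m 0 w 0 tpo ggu_even.
rewrite expr0 scale1r big_ord0 => tu; apply/eqP; rewrite -subr_eq0.
by apply/eqP/tu => j _; rewrite tp_ggu (Y0l vaY) scaler0.
Qed.

(** The products of [tm] with [ggu] are [T gu] and [gu], so the commutator is
    [(T gu)_(m) + m gu_(m-1)], which is zero by [Y_transl]. *)
Lemma tm_ggu0_comm m w : Y tm m (Y ggu 0 w) = Y ggu 0 (Y tm m w).
Proof.
have := @commutator _ _ _ _ _ vaY true false tm ggu m 0 w 2 tmo ggu_even.
rewrite expr0 scale1r => tu; apply/eqP; rewrite -subr_eq0 {}tu.
  rewrite big_ord_recr big_ord1 /= binz0 binz1 scale1r !addr0 tm0_ggu.
  rewrite tm_succ_ggu jj0_gu (Y_transl vaY par_split) scaleN1r opprK.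
  by rewrite addNr.
case=> [//|[//|j]] _.
by rewrite tm_succ_ggu jj_gu scaler0 (Y0l vaY) scaler0.
Qed.

(** [J_n] and [L_0] are polynomials in the modes of [tp] and [tm]. *)
Lemma jj_ggu0_comm n w : Y jj n (Y ggu 0 w) = Y ggu 0 (Y jj n w).
Proof.
rewrite !jj_from_tau [in RHS]linearB !linearD /=.
by rewrite !(tp_ggu0_comm, tm_ggu0_comm).
Qed.

Lemma om1_ggu0_comm w : Y om 1 (Y ggu 0 w) = Y ggu 0 (Y om 1 w).
Proof.
rewrite !om1_from_tau_m [in RHS]linearB linearD [Y ggu 0 (_ *: _)]linearZ /=.
by rewrite jj_ggu0_comm !(tp_ggu0_comm, tm_ggu0_comm).
Qed.

Lemma Vrs_bracket r s v : Vrs r s v -> Vrs r s (bracket u v).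
Proof.
move=> /VrsE[Lv Jv]; apply/VrsE.
by rewrite bracketE om1_ggu0_comm jj_ggu0_comm Lv Jv !linearZ.
Qed.

Lemma Pij_bracket r s v : v \in Pij r s -> bracket u v \in Pij r s.
Proof.
case/PijP => Vv tpv tmv jjv; apply/PijP; rewrite bracketE.
split=> [|n n0|n n0|n n0]; first exact: Vrs_bracket.
- by rewrite tp_ggu0_comm tpv // linear0.
- by rewrite tm_ggu0_comm tmv // linear0.
- by rewrite jj_ggu0_comm jjv // linear0.
Qed.

Lemma Gimage_bracket v : v \in Gimage -> bracket u v \in Gimage.
Proof.
case/GimageP => y [z [Vy Vz ->]]; rewrite bracketE linearD /=.
rewrite -tp_ggu0_comm -tm_ggu0_comm.
by rewrite rpredD ?Gimage_tp ?Gimage_tm //; apply: Vrs_bracket.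
Qed.

End Primary.

(** The zeroth mode [ggu_(0)] is a derivation of the products, and it commutes
    with the operators that send [v] to [ggv]. *)
Lemma bracket_leibniz u v w : u \in Pij 0 0 -> v \in Pij 0 0 ->
  bracket u (bracket v w) = bracket (bracket u v) w + bracket v (bracket u w).
Proof.
move=> Pu Pv; rewrite !bracketE //.
rewrite (Y0_derivation vaY _ _ (ggu_even Pu) (ggu_even Pv)).
by rewrite scale1r tm_ggu0_comm // tp_ggu0_comm.
Qed.

(** [T (y_(n) vac) = - n y_(n-1) vac], so the modes [n <= -2] of [y] on the
    vacuum are translates. The weight of [y] is the one for which the vector
    translated has weight [-1]. *)
Lemma Gimage_deep_mode y (j : nat) : Vrs (- 1 - j%:R) 0 y ->
  Y y (- 2 - j%:Z) vac \in Gimage.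
Proof.
move=> Vy; set z := Y y (- 1 - j%:Z) vac.
have Vz : Vrs (- 1) 0 z.
  have := Vrs_Y (- 1 - j%:Z) Vy Vrs_vac; congr Vrs; last exact: addr0.
  by rewrite rmorphB /= rmorphN /=; ring.
have -> : Y y (- 2 - j%:Z) vac = j.+1%:R^-1 *: T z.
  rewrite (transl_Y vaY par_split) [T vac](Yvac vaY) //.
  rewrite linear0 add0r (Y_transl vaY par_split) -scaleNr scalerA.
  rewrite -rmorphN /= (_ : - (- 1 - j%:Z) = j.+1); last by lia.
  rewrite mulVf ?pnatr_eq0 // scale1r; congr (Y y _ vac); lia.
exact/rpredZ/Gimage_transl.
Qed.

(** Moving [G^+_(-1/2)] and [G^-_(-1/2)] across the product turns
    [ggu_(0) v] into [u_(0) ggv] modulo [Gimage], and skew-symmetry turns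
    [u_(0) ggv] into [- ggv_(0) u]. *)
Lemma bracket_anticomm u v : u \in Pij 0 0 -> v \in Pij 0 0 ->
  bracket u v + bracket v u \in Gimage.
Proof.
move=> Pu Pv; have [Vu Vv] : Vrs 0 0 u /\ Vrs 0 0 v.
  by case/PijP: Pu => ? _ _ _; case/PijP: Pv => ? _ _ _.
set gu := Y tm 0 u; set ggv := Y tp 0 (Y tm 0 v).
have Vggv : Vrs 1 0 ggv.
  by have := Vrs_tp0 (Vrs_tm0 Vv); congr Vrs; field.
have tpD := Y0_derivation vaY 0 v tpo (gu_odd Pu).
have tmD := Y0_derivation vaY 0 (Y tp 0 v) tmo (primary_even Pu).
have -> : bracket u v = Y tp 0 (Y gu 0 v) + Y tm 0 (Y u 0 (Y tp 0 v))
    - T (Y u 0 v) + Y u 0 ggv.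
  rewrite bracketE // tpD tmD expr1 expr0 scaleN1r scale1r addrA subrK.
  have -> : Y tm 0 (Y tp 0 v) = T v - ggv.
    by rewrite transl_from_tau addrC addKr.
  rewrite linearB /= (transl_Y vaY par_split).
  rewrite (Y_transl vaY par_split) scale0r oppr0 addr0.
  by rewrite addrA addrAC addrK subrK.
rewrite (bracketE v u).
have [N ->] := skew_symmetry vaY (primary_even Pu) (ggu_even Pv).
rewrite big_ord_recl binz0 scale1r subr0 (va_creation vaY) opprD addrA addrK.
rewrite -/ggv rpredB ?rpredB ?rpredD //.
- apply: Gimage_tp; have := Vrs_Y 0 (Vrs_tm0 Vu) Vv.
  by congr Vrs; field.
- apply: Gimage_tm; have := Vrs_Y 0 Vu (Vrs_tp0 Vv).
  by congr Vrs; field.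
- apply: Gimage_transl; have := Vrs_Y 0 Vu Vv.
  by congr Vrs; field.
apply: rpred_sum => j _; apply: rpredZ.
rewrite lift0 (_ : - 1 - j.+1%:Z = - 2 - j%:Z); last by lia.
apply: Gimage_deep_mode; have := Vrs_Y j.+1 Vu Vggv.
congr Vrs; last exact: addr0.
by rewrite -pmulrn -natr1; field.
Qed.

End Superconformal.

(** * Lie brackets on subquotients *)

Section SubquotientLie.
Variables (K : numFieldType) (V : lmodType K) (P N : submodClosed V).
Variable b : V -> V -> V.
Hypothesis b_linear_l : forall v, linear (b^~ v).
Hypothesis b_linear_r : forall u, linear (b u).
Hypothesis b_P : {in P &, forall u v, b u v \in P}.
Hypothesis b_Nl : forall u v, u \in P -> v \in P -> u \in N -> b u v \in N.
Hypothesis b_Nr : forall u v, u \in P -> v \in P -> v \in N -> b u v \in N.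
Hypothesis b_anti : {in P &, forall u v, b u v + b v u \in N}.
Hypothesis b_leibniz : {in P & &, forall u v w,
  b u (b v w) = b (b u v) w + b v (b u w)}.

Local Notation pi := (@subquot_pi _ _ P N).

Let mulP (u v : submod_of P) : submod_of P :=
  exist _ (b (val u) (val v)) (b_P (valP u) (valP v)).

Let br (x y : subquot P N) : subquot P N := pi (mulP (repr x) (repr y)).

Let P_sub u v : u \in P -> v \in P -> u - v \in P.
Proof. by move=> Pu Pv; rewrite -scaleN1r rpredD ?rpredZ. Qed.

Let b_subl u u' v : b (u - u') v = b u v - b u' v.
Proof.
have /= bl := b_linear_l v (-1) u' u.
by rewrite addrC -scaleN1r bl scaleN1r addrC.
Qed.

Let b_subr u v v' : b u (v - v') = b u v - b u v'.
Proof.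
by rewrite addrC -scaleN1r b_linear_r scaleN1r addrC.
Qed.

Let br_pi u v : br (pi u) (pi v) = pi (mulP u v).
Proof.
apply/subquot_piP => /=.
set u' := repr _; set v' := repr _.
have uN : val u' - val u \in N by apply/subquot_piP/subquot_piK.
have vN : val v' - val v \in N by apply/subquot_piP/subquot_piK.
have -> : b (val u') (val v') - b (val u) (val v)
    = b (val u' - val u) (val v') + b (val u) (val v' - val v).
  by rewrite b_subl b_subr addrA subrK.
apply: rpredD; [apply: b_Nl|apply: b_Nr] => //; try exact: valP.
  exact: P_sub (valP _) (valP _).
exact: P_sub (valP _) (valP _).
Qed.

(** Antisymmetry is only required modulo [N]; the Jacobi identity is then the
    Leibniz identity rewritten by antisymmetry, and [[x, x] = 0] follows from
    [2 [x, x] = 0]. *)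
Lemma subquot_lie : exists br : subquot P N -> subquot P N -> subquot P N,
  (forall u v : submod_of P, exists2 w : submod_of P,
     val w = b (val u) (val v) & br (pi u) (pi v) = pi w)
  /\ lie_algebra br.
Proof.
exists br; split=> [u v|]; first by exists (mulP u v); rewrite ?br_pi.
have piZ a u : a *: pi u = pi (a *: u) by exact: subquot_piZ.
have br_anti x y : br x y + br y x = 0.
  rewrite -[x]subquot_piK -[y]subquot_piK !br_pi -raddfD.
  rewrite -[RHS](raddf0 pi); apply/subquot_piP.
  rewrite /= subr0; exact: b_anti (valP _) (valP _).
have br_linr x : linear (br x).
  move=> a y z; rewrite -[x]subquot_piK -[y]subquot_piK -[z]subquot_piK.
  rewrite piZ -raddfD !br_pi piZ -raddfD; congr pi; apply: val_inj.
  by rewrite /= b_linear_r.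
split=> [y a x z||x|x y z] //.
- rewrite -[x]subquot_piK -[y]subquot_piK -[z]subquot_piK.
  rewrite piZ -raddfD !br_pi piZ -raddfD; congr pi; apply: val_inj.
  by rewrite /= b_linear_l.
- have /eqP := br_anti x x; rewrite -mulr2n -scaler_nat scaler_eq0.
  by rewrite pnatr_eq0 => /eqP.
have brN u v : br u (- v) = - br u v.
  by have := br_linr u (-1) v 0; rewrite !scaleN1r !addr0 => ->;
     have := br_linr u 1 0 0; rewrite !scale1r addr0 => /eqP;
     rewrite -subr_eq subrr => /eqP <-; rewrite addr0.
have br_leibniz u v w : br u (br v w) = br (br u v) w + br v (br u w).
  rewrite -[u]subquot_piK -[v]subquot_piK -[w]subquot_piK !br_pi -raddfD.
  congr pi; apply: val_inj => /=.
  exact: b_leibniz (valP _) (valP _) (valP _).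
have opp u v : br u v = - br v u by apply/eqP; rewrite -addr_eq0 br_anti.
rewrite [br z (br x y)]opp br_leibniz (opp z x) brN.
by rewrite addrK addrN.
Qed.

End SubquotientLie.

Section SuperconformalLie.
Variables (K : numFieldType) (V : lmodType K) (par : bool -> {pred V}).
Variables (vac : V) (Y : V -> int -> {linear V -> V}).
Hypothesis vaY : vertex_superalgebra par vac Y.
Hypothesis par_submod : forall p, submod_closed (par p).
Hypothesis par_split : forall v,
  exists2 v0, v0 \in par false & exists2 v1, v1 \in par true & v = v0 + v1.
Variables (om tp tm jj : V) (c : K).
Hypothesis scY : superconformal par vac Y om tp tm jj c.

Theorem superconformal_lie :
  let pi := @Ppi K V Y om tp tm jj in
  exists br : Ptilde Y om tp tm jj -> Ptilde Y om tp tm jj ->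
              Ptilde Y om tp tm jj,
    (forall u v : P00 Y om tp tm jj,
      exists2 w : P00 Y om tp tm jj,
        val w = bracket Y tp tm (val u) (val v) & br (pi u) (pi v) = pi w)
    /\ lie_algebra br.
Proof.
apply: subquot_lie.
- move=> v a u w; rewrite /bracket /Gplus /Gminus linearP.
  by rewrite linearP (YP vaY).
- by move=> u a v w; rewrite /bracket linearP.
- by move=> u v Pu Pv; apply: (Pij_bracket vaY par_split scY).
- move=> u v Pu Pv uN; rewrite (bracket_Gimage vaY par_split scY) //.
  exact: rpred0.
- by move=> u v Pu Pv; apply: (Gimage_bracket vaY par_split scY).
- by move=> u v Pu Pv; apply: (bracket_anticomm vaY par_submod par_split scY).
- by move=> u v w Pu Pv Pw; apply: (bracket_leibniz vaY par_split scY).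
Qed.

End SuperconformalLie.

(** * The superconformal structure of a free field algebra *)

Lemma linear_comb (K : pzRingType) (U V : lmodType K) (phi : U -> V)
    (I : finType) (c d : I -> K) (x y : I -> U) : linear phi ->
  phi (\sum_i (c i *: x i + d i *: y i))
  = \sum_i (c i *: phi (x i) + d i *: phi (y i)).
Proof.
move=> phi_lin.
have phi0 : phi 0 = 0.
  by have := phi_lin (-1) 0 0; rewrite scaler0 addr0 scaleN1r addNr.
have phiD u v : phi (u + v) = phi u + phi v.
  by rewrite -[u]scale1r phi_lin !scale1r.
rewrite (big_morph phi phiD phi0); apply: eq_bigr => i _.
by rewrite phi_lin -[d i *: _]addr0 phi_lin phi0 addr0.
Qed.

Section FreeFields.
Variables (K : numFieldType) (V : lmodType K) (par : bool -> {pred V}).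
Variables (vac : V) (Y : V -> int -> {linear V -> V}).
Hypothesis vaY : vertex_superalgebra par vac Y.
Hypothesis par_submod : forall p, submod_closed (par p).
Hypothesis par_split : forall v,
  exists2 v0, v0 \in par false & exists2 v1, v1 \in par true & v = v0 + v1.
(* [e false i], [e true i], [f false i], [f true i] stand for [h_i^+], [h_i^-],
   [a_i], [a_i^*]. The involution that flips the booleans exchanges [tau^+]
   and [tau^-], so that each product is computed once. *)
Variables (l : nat) (e f : bool -> 'I_l -> V).
Hypothesis e_even : forall s i, e s i \in par false.
Hypothesis f_odd : forall s i, f s i \in par true.
Hypothesis e_e : forall s t i j (k : nat),
  Y (e s i) k (e t j) = [&& s != t, i == j & k == 1%N]%:R *: vac.
Hypothesis f_f : forall s t i j (k : nat),
  Y (f s i) k (f t j) = [&& s != t, i == j & k == 0%N]%:R *: vac.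
Hypothesis e_f : forall s t i j (k : nat), Y (e s i) k (f t j) = 0.
Hypothesis f_e : forall s t i j (k : nat), Y (f s i) k (e t j) = 0.

Local Notation T := (transl vac Y).

Definition free_tau s : V := \sum_i Y (e s i) (-1) (f s i).
Definition free_j : V := \sum_i Y (f false i) (-1) (f true i).
Definition free_omega : V :=
  \sum_i Y (e false i) (-1) (e true i)
  + 2^-1 *: \sum_i (Y (f false i) (-2) (f true i)
                    + Y (f true i) (-2) (f false i)).

Lemma free_tau_odd s : free_tau s \in par true.
Proof.
by apply: (par_sum par_submod) => i _; apply: (par_Y vaY _ (e_even s i)).
Qed.

Lemma free_j_even : free_j \in par false.
Proof.
apply: (par_sum par_submod) => i _.
exact: (par_Y vaY _ (f_odd false i) (f_odd true i)).
Qed.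

Lemma free_omega_even : free_omega \in par false.
Proof.
apply: (parD par_submod).
  apply: (par_sum par_submod) => i _.
  exact: (par_Y vaY _ (e_even false i) (e_even true i)).
apply/(parZ par_submod)/(par_sum par_submod) => i _.
apply: (parD par_submod).
  exact: (par_Y vaY _ (f_odd false i) (f_odd true i)).
exact: (par_Y vaY _ (f_odd true i) (f_odd false i)).
Qed.

(** Among the terms of the normally ordered product only the contraction with
    the factor [e s i] survives; the right-hand side is [T (f s i)] for
    [n = 0], [f s i] for [n = 1] and zero for larger [n]. *)
Lemma free_tau_e s t i (n : nat) :
  Y (free_tau s) n (e t i) = (s != t)%:R *: Y (f s i) (n%:Z - 2) vac.
Proof.
rewrite (Ysum vaY) (bigD1 i) //= big1 ?addr0 => [|m mi]; last first.
  rewrite (@iterate _ _ _ _ _ vaY false true _ _ _ _ _ 0) ?big_ord0 //.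
  - by move=> j _; rewrite -PoszD f_e.
  - by move=> j _; rewrite e_e (negbTE mi) andbF scale0r.
rewrite (@iterate _ _ _ _ _ vaY false true _ _ _ _ _ 2) //.
- rewrite big_ord_recr big_ord1 /= -!PoszD !f_e !e_e !linear0 !sub0r /=.
  rewrite binz1 eqxx !andbF scale0r linear0 scaler0 oppr0 scaler0 add0r andbT.
  rewrite [Y _ _ (_ *: _)]linearZ /= expr1 expr0 mul1r scalerN !scalerA.
  rewrite -scaleNr.
  rewrite (_ : n%:Z - 1 - 1 = n%:Z - 2); last by lia.
  by congr (_ *: _); rewrite -[(-1) ^ (-1)]/((-1)^-1) invrN1; ring.
- by move=> j _; rewrite -PoszD f_e.
- by case=> [|[|j]] // _; rewrite e_e !andbF scale0r.
Qed.

Lemma free_tau_f s t i (n : nat) :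
  Y (free_tau s) n (f t i) = ((s != t) && (n == 0%N))%:R *: e s i.
Proof.
rewrite (Ysum vaY) (bigD1 i) //= big1 ?addr0 => [|m mi]; last first.
  rewrite (@iterate _ _ _ _ _ vaY false true _ _ _ _ _ 0) ?big_ord0 //.
  by move=> j _; rewrite -PoszD f_f (negbTE mi) andbF scale0r.
rewrite (@iterate _ _ _ _ _ vaY false true _ _ _ _ _ 1) //.
- rewrite big_ord1 /= binz0 addr0 f_f e_f linear0 scaler0 subr0 eqxx.
  rewrite [Y _ _ (_ *: _)]linearZ /= (va_creation vaY) expr0 mul1r scale1r.
  by rewrite addn0.
- by move=> j j1; rewrite -PoszD f_f addn_eq0 -[j == 0%N]negbK -lt0n j1 !andbF
    scale0r.
Qed.

Lemma free_j_annihilated (n : nat) x :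
  (forall s i (k : nat), Y (f s i) k x = 0) -> Y free_j n x = 0.
Proof.
move=> fx; rewrite (Ysum vaY) big1 // => i _.
rewrite (@iterate _ _ _ _ _ vaY true true _ _ _ _ _ 0) ?big_ord0 //.
by move=> j _; rewrite -PoszD fx.
Qed.

Lemma free_j_e (n : nat) t i : Y free_j n (e t i) = 0.
Proof. by apply: free_j_annihilated => *; apply: f_e. Qed.

Lemma free_j_f (n : nat) t i :
  Y free_j n (f t i) = (n == 0%N)%:R *: ((-1) ^+ t *: f t i).
Proof.
rewrite (Ysum vaY) (bigD1 i) //= big1 ?addr0 => [|m mi]; last first.
  rewrite (@iterate _ _ _ _ _ vaY true true _ _ _ _ _ 0) ?big_ord0 //.
  - by move=> j _; rewrite -PoszD f_f (negbTE mi) andbF scale0r.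
  - by move=> j _; rewrite f_f (negbTE mi) andbF scale0r.
rewrite (@iterate _ _ _ _ _ vaY true true _ _ _ _ _ 1) //.
- rewrite big_ord1 /= binz0 addr0 !f_f eqxx /= expr0 mul1r scale1r expr1.
  rewrite -[(-1) ^ (-1)]/((-1)^-1) invrN1 mulrNN mulr1 scale1r.
  rewrite ![Y _ _ (_ *: _)]linearZ /= (va_creation vaY) addn0 addr0.
  case: t => /=; last by rewrite expr0 scale0r subr0 scale1r.
  rewrite scale0r sub0r scale1r expr1 scaleN1r.
  case: n => [|n]; first by rewrite scale1r (va_creation vaY).
  by rewrite scale0r (Y_vac_ge0 vaY) ?oppr0 //; lia.
- by move=> j j1; rewrite -PoszD f_f addn_eq0 -[j == 0%N]negbK -lt0n j1 !andbF
    scale0r.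
- by case=> [//|j] _; rewrite f_f !andbF scale0r.
Qed.

Lemma free_j_Y_neutral n c u x : (forall s i (k : nat), Y (f s i) k u = 0) ->
  Y free_j 0 x = c *: x -> Y free_j 0 (Y u n x) = c *: Y u n x.
Proof.
move=> fu jx; rewrite (even_derivation vaY par_split) ?free_j_even // jx.
by rewrite (free_j_annihilated 0 fu) (Y0l vaY) addr0 linearZ.
Qed.

Lemma free_j_Y_f n c s i a x : Y free_j 0 x = c *: x ->
  Y free_j 0 (a *: Y (f s i) n x) = (c + (-1) ^+ s) *: (a *: Y (f s i) n x).
Proof.
move=> jx; rewrite linearZ /= (even_derivation vaY par_split) ?free_j_even //.
rewrite jx (free_j_f 0) scale1r (YZ vaY) [Y _ _ (_ *: _)]linearZ /= -scalerDl.
by rewrite !scalerA mulrC.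
Qed.

Lemma free_j_tau (n : nat) s :
  Y free_j n (free_tau s) = (n == 0%N)%:R *: ((-1) ^+ s *: free_tau s).
Proof.
rewrite linear_sum /free_tau !scaler_sumr; apply: eq_bigr => i _.
rewrite (even_commutator vaY par_split) ?free_j_even //.
rewrite free_j_f ![Y _ _ (_ *: _)]linearZ /= big1 ?addr0 // => j _.
by rewrite free_j_e (Y0l vaY) scaler0.
Qed.

(** Let [tau_(k)] act on [e_(-1) f] as a superderivation. The commutator with
    [e_(-1)] combines the products of [free_tau_e] for [n = 0] and [n = 1]
    into a single mode of [f s i]. *)
Lemma free_tau_tau s t (k : nat) : Y (free_tau s) k (free_tau t) =
  (s != t)%:R *: \sum_i (Y (f s i) (k%:Z - 2) (f t i)
                         + (k == 0%N)%:R *: Y (e t i) (-1) (e s i)).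
Proof.
rewrite linear_sum scaler_sumr; apply: eq_bigr => i _.
have := @commutator _ _ _ _ _ vaY true false (free_tau s) (e t i) k (-1) (f t i)
  2 (free_tau_odd s) (e_even t i).
rewrite expr0 scale1r => tt; apply/eqP; rewrite -[X in X == _]subr0.
rewrite -{1}(subrr (Y (e t i) (-1) (Y (free_tau s) k (f t i)))) opprB addrA.
rewrite addrAC {}tt => [|[|[|j]]] //; last first.
  by move=> _; rewrite free_tau_e (Y_vac_ge0 vaY) ?scaler0 ?(Y0l vaY) ?scaler0
    //; lia.
rewrite big_ord_recr big_ord1 /= binz0 binz1 scale1r !free_tau_e !(YZ vaY).
rewrite sub0r -/(T (f s i)) (Y_transl vaY par_split) subr0.
rewrite (_ : 1%:Z - 2 = -1) // (va_creation vaY) free_tau_f.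
rewrite [Y _ _ (_ *: e s i)]linearZ /= scalerDr; apply/eqP.
rewrite [in RHS]scalerA -natrM mulnb.
rewrite (_ : k%:Z - 1 - 1 = k%:Z - 2); last by lia.
congr (_ + _); rewrite scalerN -scaleNr !scalerA -scalerDl.
by congr (_ *: _); rewrite rmorphD /=; ring.
Qed.

Lemma free_f_swap i :
  Y (f false i) (-1) (T (f true i)) = - Y (f true i) (-2) (f false i).
Proof.
have := @commutator _ _ _ _ _ vaY true true (f false i) (f true i) (-1) (-2) vac
  1 (f_odd false i) (f_odd true i).
rewrite expr1 scaleN1r opprK (va_creation vaY) big_ord1 /= f_f (YZ vaY).
rewrite (Yvac vaY) // !scaler0 -/(T _) => /(_ _)/eqP; rewrite addr_eq0.
move=> /(_ _)/eqP; apply => -[//|j] _.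
by rewrite f_f !andbF scale0r (Y0l vaY) scaler0.
Qed.

Lemma free_e_swap i :
  Y (e true i) (-1) (e false i) = Y (e false i) (-1) (e true i).
Proof.
have := @commutator _ _ _ _ _ vaY false false (e true i) (e false i) (-1) (-1)
  vac 2 (e_even true i) (e_even false i).
rewrite scale1r !(va_creation vaY) => ee; apply/eqP; rewrite -subr_eq0.
apply/eqP; rewrite ee => [|[|[|j]]] //; last first.
  by rewrite e_e !andbF scale0r (Y0l vaY) scaler0.
rewrite big_ord_recr big_ord1 /= !e_e !(YZ vaY) !andbF !scale0r.
by rewrite !(Yvac vaY) // !scaler0 addr0.
Qed.

Lemma transl_free_j :
  T free_j = \sum_i (Y (f false i) (-2) (f true i)
                     - Y (f true i) (-2) (f false i)).
Proof.
rewrite /transl (Ysum vaY); apply: eq_bigr => i _.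
rewrite -/(T _) (transl_Y vaY par_split) free_f_swap addrC.
by rewrite (Y_transl vaY par_split) -scaleNr -rmorphN /= opprK scale1r.
Qed.

Lemma free_tau0_tau :
  Y (free_tau false) 0 (free_tau true) = free_omega + 2^-1 *: T free_j.
Proof.
rewrite free_tau_tau scale1r transl_free_j /free_omega -addrA -scalerDr.
rewrite -!big_split /= scaler_sumr -big_split /=; apply: eq_bigr => i _.
rewrite scale1r free_e_swap addrC; congr (_ + _).
rewrite sub0r addrACA subrr addr0 -mulr2n -scaler_nat scalerA mulVf ?scale1r //.
by rewrite pnatr_eq0.
Qed.

Lemma free_tau_transl s x : Y (free_tau s) 0 (T x) = T (Y (free_tau s) 0 x).
Proof.
rewrite (transl_Y vaY par_split) (Y_transl vaY par_split).
by rewrite scale0r oppr0 addr0.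
Qed.

(** [{G^+_(-1/2), G^-_(-1/2)} = L_(-1)], since [(T j)_(0) = 0]. *)
Lemma free_omega0E x : Y free_omega 0 x =
  Y (free_tau false) 0 (Y (free_tau true) 0 x)
  + Y (free_tau true) 0 (Y (free_tau false) 0 x).
Proof.
rewrite (Y0_derivation vaY _ _ (free_tau_odd false) (free_tau_odd true)).
rewrite expr1 scaleN1r subrK free_tau0_tau (YD vaY) (YZ vaY).
by rewrite (Y_transl vaY par_split) scale0r oppr0 scaler0 addr0.
Qed.

Lemma free_omega0_e s i : Y free_omega 0 (e s i) = T (e s i).
Proof.
have tau0 t : Y (free_tau t) 0 (e s i) = (t != s)%:R *: T (f t i).
  by rewrite (free_tau_e t s i 0) sub0r.
rewrite free_omega0E !tau0 ![Y _ _ (_ *: _)]linearZ /= !free_tau_transl.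
rewrite !(free_tau_f _ _ _ 0) !andbT.
by case: s {tau0} => /=; rewrite !scale0r !scale1r ?addr0 ?add0r.
Qed.

Lemma free_omega0_f s i : Y free_omega 0 (f s i) = T (f s i).
Proof.
rewrite free_omega0E !(free_tau_f _ _ _ 0) !andbT.
rewrite ![Y _ _ (_ *: _)]linearZ /=.
by case: s => /=; rewrite !scale0r !scale1r ?addr0 ?add0r
  (free_tau_e _ _ _ 0) scale1r sub0r.
Qed.

(** Both [omega_(0)] and [T] are derivations of all the products. *)
Lemma free_omega0_Y u n x : Y free_omega 0 u = T u -> Y free_omega 0 x = T x ->
  Y free_omega 0 (Y u n x) = T (Y u n x).
Proof.
move=> uT xT; rewrite (transl_Y vaY par_split).
by rewrite (even_derivation vaY par_split) ?free_omega_even // uT xT.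
Qed.

Lemma free_omega0_lin a u v :
  Y free_omega 0 u = T u -> Y free_omega 0 v = T v ->
  Y free_omega 0 (a *: u + v) = T (a *: u + v).
Proof. by move=> uT vT; rewrite linearP uT vT (transl_is_linear vaY). Qed.

Lemma free_omega00 : Y free_omega 0 0 = T 0.
Proof. by rewrite linear0 /transl (Y0l vaY). Qed.

Lemma free_omega0Z a u : Y free_omega 0 u = T u ->
  Y free_omega 0 (a *: u) = T (a *: u).
Proof.
by move=> uT; rewrite -[a *: u]addr0 free_omega0_lin // free_omega00.
Qed.

Lemma mode_comb (c d : 'I_l -> K) n v :
  Y (\sum_i (c i *: e false i + d i *: e true i)) n v
  = \sum_i (c i *: Y (e false i) n v + d i *: Y (e true i) n v).
Proof.
by rewrite (Ysum vaY); apply: eq_bigr => i _; rewrite (YD vaY) !(YZ vaY).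
Qed.

Lemma free_omega0_comb (c d : 'I_l -> K) :
  Y free_omega 0 (\sum_i (c i *: e false i + d i *: e true i))
  = T (\sum_i (c i *: e false i + d i *: e true i)).
Proof.
apply: (big_ind (fun u => Y free_omega 0 u = T u)) => [|u v uT vT|i _].
- exact: free_omega00.
- by rewrite -[u]scale1r; apply: free_omega0_lin.
apply: free_omega0_lin; first exact: free_omega0_e.
exact/free_omega0Z/free_omega0_e.
Qed.

(** On a vector annihilated by all the positive modes the normally ordered
    square has a single term for each [i]. *)
Lemma free_omega0_highest (d : bool -> 'I_l -> K) x :
    (forall s i (k : nat), Y (f s i) k x = 0) ->
    (forall s i (k : nat), Y (e s i) k.+1 x = 0) ->
    (forall s i, Y (e s i) 0 x = d s i *: x) ->
  Y free_omega 0 x = \sum_i (d true i *: Y (e false i) (-1) x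
                             + d false i *: Y (e true i) (-1) x).
Proof.
move=> fx ex e0x; rewrite (YD vaY) (YZ vaY) !(Ysum vaY).
rewrite [X in _ *: X]big1 ?scaler0 ?addr0 => [|i _]; last first.
  have ff s t : Y (Y (f s i) (-2) (f t i)) 0 x = 0.
    rewrite (@iterate _ _ _ _ _ vaY true true _ _ _ _ _ 0) ?big_ord0 //.
    by move=> j _; rewrite add0r fx.
  by rewrite (YD vaY) !ff addr0.
apply: eq_bigr => i _.
rewrite (@iterate _ _ _ _ _ vaY false false _ _ _ _ _ 1) //.
- rewrite big_ord1 /= binz0 expr0 !mul1r scale1r addr0 !e0x.
  rewrite -[(-1) ^ (-1)]/((-1)^-1) invrN1 scaleN1r opprK.
  by rewrite ![Y _ _ (_ *: _)]linearZ.
- by case=> [//|j] _; rewrite add0r ex.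
- by case=> [//|j] _; rewrite ex.
Qed.

Theorem free_superconformal :
  (forall x, Y free_omega 0 x = T x) ->
  (forall x, Y free_j 0 x = 0 -> x \in par false) ->
  superconformal par vac Y free_omega (free_tau false) (free_tau true) free_j
    l%:R.
Proof.
move=> om0 ch0; split=> //.
- exact: free_tau_odd.
- exact: free_tau_odd.
- by move=> k; rewrite free_tau_tau scale0r.
- by move=> k; rewrite free_tau_tau scale0r.
- exact: free_tau0_tau.
- by rewrite (free_tau_tau _ _ 1) scale1r; apply: eq_bigr => i _;
    rewrite scale0r addr0.
- rewrite (free_tau_tau _ _ 2) scale1r scaler_nat -[in RHS](card_ord l).
  rewrite -sumr_const; apply: eq_bigr => i _.
  by rewrite scale0r addr0 (f_f _ _ _ _ 0) eqxx scale1r.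
- case=> [|[|[|k]]] // _; rewrite free_tau_tau scale1r big1 // => i _.
  rewrite scale0r addr0 (_ : k.+3%:Z - 2 = k.+1); last by lia.
  by rewrite f_f !andbF scale0r.
- by rewrite (free_j_tau 0) !scale1r.
- by rewrite (free_j_tau 0) scale1r expr1 scaleN1r.
- by case=> // k _; rewrite free_j_tau scale0r.
- by case=> // k _; rewrite free_j_tau scale0r.
Qed.

End FreeFields.

(** * The Fock space *)

Lemma cmonom_ind (I : choiceType) (P : {cmonom I} -> Prop) :
  P (onecm I) -> (forall m i, P m -> P (mulcm m (ucm i))) -> forall m, P m.
Proof.
move=> P1 PM m; have [n] := ubnP (mdeg m); elim: n => // n IHn in m *.
move=> mn; have [->//|m1] := eqVneq m (onecm I).
have [i mi] : exists i, m i != 0%N.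
  apply: contrapT => /forallNP m0; case/eqP: m1; apply/eqP/cmP => i.
  by rewrite [RHS]cm1; apply/eqP/negPn/negP/m0.
have mE : m = mulcm (divcm m (ucm i)) (ucm i).
  apply/eqP/cmP => j; rewrite mulcmE divcmE ucmE subnK //.
  by case: eqP => // <-; rewrite lt0n.
rewrite mE; apply/PM/IHn; move: mn; rewrite {1}mE mdegM mdegU addn1.
exact.
Qed.

Lemma fset_ind_add (I : choiceType) (P : {fset I} -> Prop) :
  P fset0 -> (forall g s, g \notin s -> P s -> P (g |` s)%fset) ->
  forall s, P s.
Proof.
move=> P0 PU s; have [n] := ubnP #|` s|; elim: n => // n IHn in s *.
have [->//|[g gs]] := fset_0Vmem s.
rewrite (cardfsD1 g) gs add1n ltnS => sn.
rewrite -(fsetD1K gs); apply: PU; first by rewrite in_fsetD1 eqxx.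
exact: IHn.
Qed.

Section Malg.
Variables (K : numFieldType) (l : nat).
Local Notation V := (VNS K l).
Implicit Types (v : V) (b : fock_basis l).

Lemma fock_coeffU b b' : (<< b >> : V)@_b' = (b == b')%:R.
Proof. exact: mcoeffU. Qed.

Lemma fock_sum v : v = \sum_(b <- msupp v) v@_b *: << b >>.
Proof.
rewrite {1}[v]monalgE; apply: eq_bigr => b _.
apply/malgP => b'.
by rewrite mcoeffU mcoeffZ fock_coeffU mulr_natr.
Qed.

Lemma fock_ind (P : V -> Prop) :
  (forall a u v, P u -> P v -> P (a *: u + v)) -> P 0 ->
  (forall b, P << b >>) -> forall v, P v.
Proof.
move=> Plin P0 Pb v; rewrite [v]fock_sum; apply: (big_ind P) => //.
  by move=> u w Pu Pw; rewrite -[u]scale1r; apply: Plin.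
by move=> b _; rewrite -[_ *: _]addr0; apply: Plin.
Qed.

Lemma lextU (F : fock_basis l -> V) b : lext F << b >> = F b.
Proof. by rewrite /lext msuppU oner_eq0 big_seq_fset1 mcoeffUU scale1r. Qed.

Lemma lext0 (F : fock_basis l -> V) : lext F 0 = 0.
Proof. by rewrite /lext msupp0 big_seq_fset0. Qed.

Lemma parityP p v :
  reflect (forall b, v@_b != 0 -> odd #|` b.2| = p) (v \in parity p).
Proof.
apply: (iffP allP) => vp b.
  by rewrite mcoeff_neq0 => /vp/eqP.
by rewrite -mcoeff_neq0 => /vp/eqP.
Qed.

Lemma parity_submod p : submod_closed (@parity K l p).
Proof.
split=> [|a u v /parityP pu /parityP pv]; apply/parityP => b.
  by rewrite mcoeff0 eqxx.
rewrite mcoeffD mcoeffZ; have [ub0|/pu//] := eqVneq (u@_b) 0.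
by rewrite ub0 mulr0 add0r => /pv.
Qed.

Lemma parityU b : << b >> \in @parity K l (odd #|` b.2|).
Proof.
apply/parityP => b'; rewrite fock_coeffU; have [->//|_] := eqVneq b b'.
by rewrite eqxx.
Qed.

Lemma parity_split v : exists2 v0, v0 \in @parity K l false &
  exists2 v1, v1 \in @parity K l true & v = v0 + v1.
Proof.
have pS p (r : seq (fock_basis l)) : \sum_(b <- r | odd #|` b.2| == p)
    v@_b *: << b >> \in @parity K l p.
  apply: (par_sum (@parity_submod)) => b /eqP <-.
  exact/(parZ (@parity_submod))/parityU.
exists (\sum_(b <- msupp v | odd #|` b.2| == false) v@_b *: << b >>) => //.
exists (\sum_(b <- msupp v | odd #|` b.2| == true) v@_b *: << b >>) => //.
rewrite {1}[v]fock_sum (bigID (fun b => odd #|` b.2| == false)) /=.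
by congr (_ + _); apply: eq_bigl => b; case: odd.
Qed.

(** The coefficient of [<< b >>] in [F v] is the one in [v] times the eigenvalue
    of [b]. *)
Lemma diagonal_kernel (F : {linear V -> V}) (Q : fock_basis l -> Prop) v :
  (forall b, exists2 a, F << b >> = a *: << b >> & a = 0 -> Q b) ->
  F v = 0 -> forall b, v@_b != 0 -> Q b.
Proof.
move=> diagF Fv0 b vb; have [a Fb] := diagF b; apply.
have := congr1 (mcoeff b) Fv0; rewrite {1}[v]fock_sum linear_sum /=.
rewrite raddf_sum /= (bigD1_seq b) /= ?fset_uniq -?mcoeff_neq0 //.
rewrite big1 => [|b' b'b]; last first.
  have [a' Fb' _] := diagF b'.
  by rewrite linearZ /= Fb' !mcoeffZ fock_coeffU (negbTE b'b) !mulr0.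
rewrite linearZ /= Fb !mcoeffZ fock_coeffU eqxx mulr1 addr0 mcoeff0 => /eqP.
by rewrite mulf_eq0 (negbTE vb) => /eqP.
Qed.

End Malg.

Section FockOperators.
Variables (K : numFieldType) (l : nat) (A : 'M[int]_(l + l)).
Local Notation V := (VNS K l).
Local Notation hg := (gramf (map_mx intr A : 'M[K]_(l + l))).
Local Notation mk m mu s := (<< ((m, mu, s) : fock_basis l) >> : V).

Lemma gramf0r x : hg x 0 = 0.
Proof. by rewrite /gramf trmx0 mulmx0 mxE. Qed.

Lemma gramfE x y : hg x y = \sum_i y 0 i * hg x (delta_mx 0 i).
Proof.
rewrite {1}(row_sum_delta y) /gramf raddf_sum /= mulmx_sumr summxE.
by apply: eq_bigr => i _; rewrite linearZ /= -scalemxAr mxE.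
Qed.

Lemma heis_negE x k m mu s : heis A x (Negz k) (mk m mu s) =
  \sum_i x 0 i *: mk (mulcm m (ucm (i, k))) mu s.
Proof. exact: lextU. Qed.

Lemma heis_delta i k m mu s : heis A (delta_mx 0 i) (Negz k) (mk m mu s) =
  mk (mulcm m (ucm (i, k))) mu s.
Proof.
rewrite heis_negE (bigD1 i) //= big1 ?addr0 => [|j ji].
  by rewrite mxE !eqxx scale1r.
by rewrite mxE eqxx (negbTE ji) scale0r.
Qed.

Lemma heis0E x m mu s :
  heis A x 0 (mk m mu s) = hg x (map_mx intr mu) *: mk m mu s.
Proof. exact: lextU. Qed.

Lemma heis_pos x k (m : {cmonom (boson l)}) mu s : (forall i, m (i, k) = 0%N) ->
  heis A x k.+1%:Z (mk m mu s) = 0.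
Proof.
move=> mk0; rewrite /heis lextU /= big1 // => i _.
by rewrite mk0 muln0 mulr0n scale0r.
Qed.

Lemma heis_pos1 x i k mu s : heis A x k.+1%:Z (mk (ucm (i, 0%N)) mu s) =
  (k == 0%N)%:R *: (hg x (delta_mx 0 i) *: mk (onecm _) mu s).
Proof.
case: k => [|k]; last first.
  by rewrite scale0r heis_pos // => j; rewrite ucmE xpair_eqE andbF.
rewrite scale1r /heis lextU /= (bigD1 i) //= big1 ?addr0 => [|j ji].
  rewrite ucmE eqxx muln1 mulr1n (_ : divcm _ _ = onecm (boson l)) //.
  by apply/eqP/cmP => p; rewrite divcmE subnn; apply/esym/cm1.
by rewrite ucmE xpair_eqE eq_sym (negbTE ji) muln0 mulr0n scale0r.
Qed.

Lemma ferm_pos i t k m mu s : ((i, ~~ t, k) : fermion l) \notin s ->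
  ferm i t k%:Z (mk m mu s) = 0.
Proof. by move=> gs; rewrite /ferm lextU /= (negbTE gs). Qed.

Lemma fsign_sqr g (s : {fset (fermion l)}) : fsign K g s * fsign K g s = 1.
Proof. by rewrite /fsign -expr2 sqrr_sign. Qed.

Lemma ferm_negE i t k m mu s : ((i, t, k) : fermion l) \notin s ->
  ferm i t (Negz k) (mk m mu s)
  = fsign K (i, t, k) s *: mk m mu ((i, t, k) |` s)%fset.
Proof. by move=> gs; rewrite /ferm lextU /= (negbTE gs). Qed.

Lemma fsign0 g : fsign K g (fset0 : {fset (fermion l)}) = 1.
Proof.
rewrite /fsign (_ : [fset h in fset0 | _]%fset = fset0) ?cardfs0 //.
by apply/fsetP => h; rewrite !inE.
Qed.

Lemma fsign1 g : fsign K g ([fset g]%fset : {fset (fermion l)}) = 1.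
Proof.
rewrite /fsign (_ : [fset h in _ | _]%fset = fset0) ?cardfs0 //.
by apply/fsetP => h; rewrite !inE; case: eqP => // ->; rewrite ltnn.
Qed.

Lemma heis_vacE x : heis A x (-1) (vac K l) =
  \sum_i x 0 i *: mk (ucm (i, 0%N)) 0 fset0.
Proof.
rewrite -[(-1)%R]/(Negz 0) heis_negE; apply: eq_bigr => i _.
by rewrite mul0cm.
Qed.

Lemma ferm_vacE i t : ferm i t (-1) (vac K l) =
  mk (onecm _) 0 [fset ((i, t, 0%N) : fermion l)]%fset.
Proof. by rewrite -[(-1)%R]/(Negz 0) ferm_negE // fsign0 scale1r fsetU0. Qed.

Lemma ferm_pos1 i t k j t' : ferm i t k%:Z (ferm j t' (-1) (vac K l)) =
  [&& t != t', i == j & k == 0%N]%:R *: vac K l.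
Proof.
rewrite ferm_vacE; have [/and3P[tt' /eqP-> /eqP->]|ne] := boolP [&& _, _ & _].
  have t'E : t' = ~~ t by case: t t' tt' => [] [].
  rewrite t'E scale1r /ferm lextU /= inE eqxx fsign1 scale1r.
  by rewrite (_ : (_ `\ _)%fset = fset0) //; apply/fsetP => g; rewrite !inE;
     case: eqP.
rewrite scale0r ferm_pos // inE; apply: contra ne => /eqP[-> <- ->].
by rewrite !eqxx; case: t.
Qed.

(** * Fock space as a vertex superalgebra *)

Variables (eps : 'rV[int]_(l + l) -> 'rV[int]_(l + l) -> int).
Hypothesis eps0 : forall lam, eps lam 0 = 1.
Variable Y : V -> int -> {linear V -> V}.
Hypothesis vaY : vertex_superalgebra (@parity K l) (vac K l) Y.
Hypothesis genY : generating_fields A eps Y.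

Local Notation T := (transl (vac K l) Y).
Let hv x : V := heis A x (-1) (vac K l).
Let fv i t : V := ferm i t (-1) (vac K l).

Lemma heisE x n v : heis A x n v = Y (hv x) n v.
Proof. by rewrite (gen_heis genY). Qed.

Lemma fermE i t n v : ferm i t n v = Y (fv i t) n v.
Proof. by rewrite (gen_ferm genY). Qed.

Lemma hv_linear : linear hv.
Proof.
move=> a x y; rewrite /hv !heis_vacE scaler_sumr -big_split /=.
by apply: eq_bigr => i _; rewrite !mxE scalerDl scalerA.
Qed.

Lemma heis_hv x y (k : nat) :
  Y (hv x) k (hv y) = ((k == 1%N)%:R * hg x y) *: vac K l.
Proof.
rewrite {2}/hv heis_vacE linear_sum /= gramfE mulr_sumr scaler_suml.
apply: eq_bigr => i _; rewrite linearZ -heisE /=; case: k => [|k].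
  by rewrite heis0E map_mx0 gramf0r scale0r scaler0 mul0r scale0r.
by rewrite heis_pos1 !scalerA mulrCA mulrA.
Qed.

Lemma heis_fv x i t (k : nat) : Y (hv x) k (fv i t) = 0.
Proof.
rewrite -heisE /fv ferm_vacE; case: k => [|k].
  by rewrite heis0E map_mx0 gramf0r scale0r.
by rewrite heis_pos // => j; rewrite cm1.
Qed.

Lemma ferm_hv i t x (k : nat) : Y (fv i t) k (hv x) = 0.
Proof.
rewrite /hv heis_vacE linear_sum big1 // => j _.
by rewrite linearZ -fermE /= ferm_pos ?scaler0.
Qed.

Lemma ferm_fv i t j t' (k : nat) : Y (fv i t) k (fv j t') =
  [&& t != t', i == j & k == 0%N]%:R *: vac K l.
Proof. by rewrite -fermE ferm_pos1. Qed.

Lemma heis0_expv x lam :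
  Y (hv x) 0 (expv K lam) = hg x (map_mx intr lam) *: expv K lam.
Proof. by rewrite -heisE heis0E. Qed.

Lemma heis_expv x (k : nat) lam : Y (hv x) k.+1 (expv K lam) = 0.
Proof. by rewrite -heisE heis_pos // => j; rewrite cm1. Qed.

Lemma ferm_expv i t (k : nat) lam : Y (fv i t) k (expv K lam) = 0.
Proof. by rewrite -fermE ferm_pos. Qed.

Lemma hv_even x : hv x \in @parity K l false.
Proof.
rewrite /hv heis_vacE; apply: (par_sum (@parity_submod K l)) => i _.
apply: (parZ (@parity_submod K l)).
by have := parityU K (ucm (i, 0%N), 0, fset0); rewrite cardfs0.
Qed.

Lemma fv_odd i t : fv i t \in @parity K l true.
Proof.
rewrite /fv ferm_vacE.
have := parityU K (onecm (boson l), 0, [fset (i, t, 0%N)]%fset).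
by rewrite cardfs1.
Qed.

Lemma fock_basis_ind (Q : fock_basis l -> Prop) :
  (forall mu, Q (onecm _, mu, fset0)) ->
  (forall m mu s i k, Q (m, mu, s) -> Q (mulcm m (ucm (i, k)), mu, s)) ->
  (forall m mu s g, g \notin s -> Q (m, mu, s) -> Q (m, mu, (g |` s)%fset)) ->
  forall b, Q b.
Proof.
move=> Q1 Qb Qf [[m mu] s].
elim/cmonom_ind: m => [|m [i k] IHm]; last exact: Qb.
by elim/fset_ind_add: s => [//|g s gs IHs]; apply: Qf.
Qed.

Lemma fock_boson i k m mu s :
  mk (mulcm m (ucm (i, k))) mu s = Y (hv (delta_mx 0 i)) (Negz k) (mk m mu s).
Proof. by rewrite -heisE heis_delta. Qed.

Lemma fock_fermion i t k m mu s : ((i, t, k) : fermion l) \notin s ->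
  mk m mu ((i, t, k) |` s)%fset
  = fsign K (i, t, k) s *: Y (fv i t) (Negz k) (mk m mu s).
Proof. by move=> gs; rewrite -fermE ferm_negE // scalerA fsign_sqr scale1r. Qed.


Lemma fpow0 (B : nat -> V -> V) m k : (forall i, B i 0 = 0) -> fpow B m k 0 = 0.
Proof.
move=> B0; elim: m k => [|m IHm] k /=; first by rewrite if_same.
by rewrite big1 // => i _; rewrite IHm B0.
Qed.

Lemma fexp0 (B : nat -> V -> V) k : (forall i, B i 0 = 0) -> fexp B k 0 = 0.
Proof.
by move=> B0; rewrite /fexp big1 // => m _; rewrite fpow0 // scaler0.
Qed.

Lemma fexp_annihilated (B : nat -> V -> V) v k :
  (forall i, B i 0 = 0) -> (forall i, B i v = 0) ->
  fexp B k v = if k == 0%N then v else 0.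
Proof.
move=> B0 Bv; rewrite /fexp big_ord_recl /= invr1 scale1r.
rewrite big1 ?addr0 // => m _; rewrite /bump /= add1n big1 ?scaler0 // => i _.
have [->|m0] := posnP m; first by rewrite /=; case: ifP => _; rewrite ?Bv ?B0.
suff -> : fpow B m (k - i) v = 0 by rewrite B0.
elim: (nat_of_ord m) (k - i)%N m0 => // m' IHm k' _ /=; rewrite big1 // => j _.
case: m' IHm => [|m'] IHm; last by rewrite IHm ?B0.
by rewrite /=; case: ifP; rewrite ?Bv ?B0.
Qed.

Lemma log_annihilation0 lam i : log_annihilation A lam i (0 : V) = 0.
Proof.
rewrite /log_annihilation; case: ifP => // _.
by rewrite heisE linear0 scaler0 oppr0.
Qed.

Lemma log_creation0 lam i : log_creation A lam i (0 : V) = 0.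
Proof.
by rewrite /log_creation; case: ifP => // _; rewrite heisE linear0 scaler0.
Qed.

(** The coefficient of [z] in [exp (lam(-1) z + ...) e^lam], the annihilation
    part of the vertex operator being trivial on the vacuum. *)
Lemma transl_expv lam :
  T (expv K lam) = heis A (map_mx intr lam) (-1) (expv K lam).
Proof.
have h0 : heis A (map_mx intr lam) 0 (vac K l) = 0%:~R *: vac K l.
  by rewrite heis0E map_mx0 gramf0r !scale0r.
have annE j : fexp (log_annihilation A lam) j (vac K l)
    = if j == 0%N then vac K l else 0.
  apply: fexp_annihilated; first exact: log_annihilation0.
  case=> [//|i]; rewrite /log_annihilation /= heis_pos ?scaler0 ?oppr0 // => p.
  by rewrite cm1.
rewrite /transl (sums_to_trunc (gen_exp genY (-2) h0) (n := 1)) => [|j j1].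
  rewrite big_ord1 annE /= /emul lextU /= eps0 scale1r addr0.
  rewrite -[(_ - 1)%N]/1%N /fexp big_ord_recl big_ord1 /=.
  rewrite scaler0 add0r invr1 scale1r big_ord_recl big_ord1 /=.
  by rewrite /log_creation /= invr1 scale1r add0r.
rewrite annE; case: j j1 => // j _ /=; rewrite /emul lext0.
exact/fexp0/log_creation0.
Qed.

(** * The N = 2 structure of the Fock space *)

Variable h : bool -> 'I_l -> 'rV[K]_(l + l).
Hypothesis h_dual : forall s t i j,
  hg (h s i) (h t j) = [&& s != t & i == j]%:R.
Hypothesis h_span : forall y, y = \sum_i (hg (h true i) y *: h false i
                                         + hg (h false i) y *: h true i).

Let e s i := hv (h s i).
Let f s i := fv i s.

Let e_even s i : e s i \in @parity K l false. Proof. exact: hv_even. Qed.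
Let f_odd s i : f s i \in @parity K l true. Proof. exact: fv_odd. Qed.

Let e_e s t i j (k : nat) :
  Y (e s i) k (e t j) = [&& s != t, i == j & k == 1%N]%:R *: vac K l.
Proof. by rewrite heis_hv h_dual mulrC -natrM mulnb -andbA. Qed.

Let f_f s t i j (k : nat) :
  Y (f s i) k (f t j) = [&& s != t, i == j & k == 0%N]%:R *: vac K l.
Proof. exact: ferm_fv. Qed.

Let e_f s t i j (k : nat) : Y (e s i) k (f t j) = 0.
Proof. exact: heis_fv. Qed.

Let f_e s t i j (k : nat) : Y (f s i) k (e t j) = 0.
Proof. exact: ferm_hv. Qed.

Let om := free_omega Y e f.
Let jj := free_j Y f.

Let par_submod := @parity_submod K l.
Let par_split := @parity_split K l.

Lemma hv_expand y : hv y =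
  \sum_i (hg (h true i) y *: e false i + hg (h false i) y *: e true i).
Proof. by rewrite {1}(h_span y) (linear_comb _ _ _ _ hv_linear). Qed.

Lemma fock_omega0_hv y : Y om 0 (hv y) = T (hv y).
Proof.
rewrite hv_expand.
exact: (free_omega0_comb vaY par_submod par_split e_even f_odd e_e f_f e_f f_e).
Qed.

(** Both sides are [lam(-1) e^lam]: for [omega_(0)] it appears through its
    coordinates along the dual bases. *)
Lemma fock_omega0_expv mu : Y om 0 (expv K mu) = T (expv K mu).
Proof.
rewrite transl_expv heisE hv_expand (mode_comb vaY).
apply: (free_omega0_highest vaY e_even f_odd
  (d := fun s i => hg (h s i) (map_mx intr mu))) => s i.
- by move=> k; apply: ferm_expv.
- by move=> k; apply: heis_expv.
- exact: heis0_expv.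
Qed.

(** The set of [x] with [omega_(0) x = T x] is a subspace stable under the
    modes of the free fields, and these generate everything from the
    [e^mu]. *)
Lemma fock_omega0 x : Y om 0 x = T x.
Proof.
have om_lin := @free_omega0_lin _ _ _ _ _ vaY l e f.
have om_0 := free_omega00 vaY e f.
have omP := free_omega0_Y vaY par_submod par_split e_even f_odd.
apply: (@fock_ind _ _ (fun x => Y om 0 x = T x)) => [//|//|b].
pose Q (b : fock_basis l) := Y om 0 << b >> = T << b >>.
suff QQ : forall b, Q b by exact: (QQ b).
apply: fock_basis_ind => [mu|m mu s i k IH|m mu s g gs IH]; rewrite /Q.
- exact: fock_omega0_expv.
- rewrite fock_boson; apply: omP; [exact: fock_omega0_hv | exact: IH].
case: g gs => [[i t] k] gs; rewrite (fock_fermion m mu gs).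
apply: (free_omega0Z vaY); apply: omP; last exact: IH.
exact: (free_omega0_f vaY par_submod par_split e_even f_odd e_e f_f e_f f_e).
Qed.

(** [J_0] is diagonal on the basis; its eigenvalue is the number of [a]'s
    minus the number of [a^*]'s, which has the parity of their total number. *)
Lemma fock_charge b : exists2 c : int,
  Y jj 0 << b >> = c%:~R *: << b >> & odd `|c|%N = odd #|` b.2|.
Proof.
pose Q (b : fock_basis l) := exists2 c : int,
  Y jj 0 << b >> = c%:~R *: << b >> & odd `|c|%N = odd #|` b.2|.
suff QQ : forall b, Q b by exact: (QQ b).
apply: fock_basis_ind => [mu|m mu s i k [c jb cs]|m mu s g gs [c jb cs]].
- exists 0; last by rewrite cardfs0.
  rewrite scale0r; apply: (free_j_annihilated vaY f_odd 0%N) => t i k.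
  exact: ferm_expv.
- exists c; last exact: cs.
  rewrite fock_boson.
  apply: (free_j_Y_neutral vaY par_submod par_split f_odd) jb => t j k'.
  exact: ferm_hv.
case: g gs => [[i t] k] gs; exists (c + (-1) ^+ t); last first.
  rewrite /= cardfsU1 gs /= -cs; case: t {gs} => /=.
    by rewrite expr1; lia.
  by rewrite expr0; lia.
rewrite (fock_fermion m mu gs) rmorphD rmorphXn /= rmorphN1.
exact: (free_j_Y_f vaY par_submod par_split f_odd f_f).
Qed.

Lemma fock_charge0_even x : Y jj 0 x = 0 -> x \in @parity K l false.
Proof.
move=> x0; apply/parityP; apply: (diagonal_kernel _ x0) => b.
have [c bc cb] := fock_charge b; exists c%:~R => // /eqP.
by rewrite intr_eq0 => /eqP c0; rewrite -cb c0.
Qed.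

Lemma fock_superconformal : superconformal (@parity K l) (vac K l) Y
  (omega A (h false) (h true)) (tau_plus A (h false)) (tau_minus A (h true))
  (jvec K l) l%:R.
Proof.
have -> : omega A (h false) (h true) = om.
  rewrite /omega /om /free_omega; congr (_ + _ *: _).
    by apply: eq_bigr => i _; rewrite heisE.
  by apply: eq_bigr => i _; rewrite (fermE i false (-2)) (fermE i true (-2)).
have -> : tau_plus A (h false) = free_tau Y e f false.
  by apply: eq_bigr => i _; rewrite heisE.
have -> : tau_minus A (h true) = free_tau Y e f true.
  by apply: eq_bigr => i _; rewrite heisE.
have -> : jvec K l = jj by apply: eq_bigr => i _; rewrite fermE.
exact: (free_superconformal vaY par_submod par_split e_even f_odd e_e f_f e_f
  f_e fock_omega0 fock_charge0_even).
Qed.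

End FockOperators.

(** * Dual isotropic bases *)

Lemma gramf_linear (S : comPzRingType) n (B : 'M[S]_n) x :
  linear (gramf B x : _ -> S^o).
Proof.
by move=> a y z; rewrite /gramf linearP /= mulmxDr -scalemxAr !mxE.
Qed.

Lemma gramf_sym (S : comPzRingType) n (B : 'M[S]_n) x y :
  B^T = B -> gramf B x y = gramf B y x.
Proof.
move=> symB; rewrite /gramf.
have -> : y *m B *m x^T = (x *m B *m y^T)^T.
  by rewrite !trmx_mul trmxK symB mulmxA.
by rewrite [RHS]mxE.
Qed.

Section DualBases.
Variables (R : realType) (l : nat) (A : 'M[int]_(l + l)).
Hypothesis symA : A^T = A.
Variables (Lp Lm : {vspace 'rV[R]_(l + l)}).
Hypothesis dec_L : isotropic_decomposition A Lp Lm.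
Variables (hp hm : l.-tuple 'rV[R]_(l + l)).
Hypothesis basis_hp : basis_of Lp hp.
Hypothesis basis_hm : basis_of Lm hm.
Local Notation g := (gramf (map_mx intr A)).
Hypothesis dual_h : forall i j : 'I_l, g (tnth hp i) (tnth hm j) = (i == j)%:R.

Let hr (s : bool) i := tnth (if s then hm else hp) i.
Definition dual_basis (s : bool) (i : 'I_l) : 'rV[R[i]]_(l + l) :=
  map_mx (real_complex R) (tnth (if s then hm else hp) i).

Let hr_dual s t i j : g (hr s i) (hr t j) = ((s != t) && (i == j))%:R.
Proof.
have symAR : (map_mx intr A : 'M[R]_(l + l))^T = map_mx intr A.
  by rewrite map_trmx symA.
case: s t => [] [] /=.
- by apply: (isodec_isom dec_L); apply: (basis_mem basis_hm); apply: mem_tnth.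
- by rewrite /hr gramf_sym // dual_h eq_sym.
- exact: dual_h.
- by apply: (isodec_isop dec_L); apply: (basis_mem basis_hp); apply: mem_tnth.
Qed.

(* The components of [y] in [L^+] and [L^-] have the coordinates
   [(h_i^-, y)] and [(h_i^+, y)], by isotropy and duality. *)
Let hr_span (y : 'rV[R]_(l + l)) : y =
  \sum_i (g (hr true i) y *: hr false i + g (hr false i) y *: hr true i).
Proof.
have : y \in (Lp + Lm)%VS by rewrite (isodec_full dec_L) memvf.
case/memv_addP => a aLp [b bLm yE].
have aE : a = \sum_i coord hp i a *: hr false i.
  rewrite {1}(coord_basis basis_hp aLp).
  by apply: eq_bigr => i _; rewrite /hr (tnth_nth 0).
have bE : b = \sum_i coord hm i b *: hr true i.
  rewrite {1}(coord_basis basis_hm bLm).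
  by apply: eq_bigr => i _; rewrite /hr (tnth_nth 0).
have gy s i : g (hr s i) y = if s then coord hp i a else coord hm i b.
  have yS : y = \sum_i (coord hp i a *: hr false i + coord hm i b *: hr true i).
    by rewrite big_split /= -aE -bE.
  rewrite yS (linear_comb _ _ _ _ (gramf_linear _ _)).
  rewrite (bigD1 i) //= big1 ?addr0 => [|j ji].
    rewrite !hr_dual eqxx !andbT; case: s => /=.
      by rewrite scaler0 addr0; apply: mulr1.
    by rewrite scaler0 add0r; apply: mulr1.
  by rewrite !hr_dual (eq_sym i) (negbTE ji) !andbF !scaler0 addr0.
rewrite {1}yE {1}aE {1}bE -big_split /=.
by apply: eq_bigr => i _; rewrite !gy.
Qed.

Local Notation rc := (real_complex R).
Local Notation gC := (gramf (map_mx intr A : 'M[R[i]]_(l + l))).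

Lemma gramf_complex x y : gC (map_mx rc x) (map_mx rc y) = rc (g x y).
Proof.
have -> : (map_mx intr A : 'M[R[i]]_(l + l)) = map_mx rc (map_mx intr A).
  by apply/matrixP => i j; rewrite !mxE rmorph_int.
by rewrite /gramf map_trmx -!map_mxM mxE.
Qed.

Lemma dual_basis_dual s t i j :
  gC (dual_basis s i) (dual_basis t j) = [&& s != t & i == j]%:R.
Proof. by rewrite gramf_complex hr_dual rmorph_nat. Qed.

(** Both sides are complex linear in [y], and the unit vectors are real. *)
Lemma dual_basis_span y : y =
  \sum_i (gC (dual_basis true i) y *: dual_basis false i
          + gC (dual_basis false i) y *: dual_basis true i).
Proof.
have real_span (x : 'rV[R]_(l + l)) (xC := map_mx rc x) : xC =
    \sum_i (gC (dual_basis true i) xC *: dual_basis false i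
            + gC (dual_basis false i) xC *: dual_basis true i).
  rewrite {1}/xC {1}(hr_span x) raddf_sum /=; apply: eq_bigr => i _.
  by rewrite map_mxD !map_mxZ !gramf_complex.
have delta_span j := real_span (delta_mx 0 j).
have gCl s i := gramf_linear (map_mx intr A) (dual_basis s i).
rewrite {1}(row_sum_delta y).
transitivity (\sum_j y 0 j *: \sum_i
    (gC (dual_basis true i) (delta_mx 0 j) *: dual_basis false i
     + gC (dual_basis false i) (delta_mx 0 j) *: dual_basis true i)).
  apply: eq_bigr => j _; congr (_ *: _).
  by have := delta_span j; rewrite map_delta_mx.
under eq_bigr do rewrite scaler_sumr.
rewrite exchange_big /=; apply: eq_bigr => i _.
under eq_bigr do rewrite scalerDr !scalerA.
by rewrite big_split /= -!scaler_suml -!gramfE.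
Qed.

End DualBases.

Theorem theorem7p8 (R : realType) (l : nat) (A : 'M[int]_(l + l))
  (even_A : even_lattice A) (sgn_A : has_signature R A)
  (Lp Lm : {vspace 'rV[R]_(l + l)}) (dec_L : isotropic_decomposition A Lp Lm)
  (eps : 'rV[int]_(l + l) -> 'rV[int]_(l + l) -> int)
  (cocycle_eps : lattice_cocycle A eps)
  (hp hm : l.-tuple 'rV[R]_(l + l))
  (basis_hp : basis_of Lp hp) (basis_hm : basis_of Lm hm)
  (dual_h : forall i j : 'I_l,
    gramf (map_mx intr A) (tnth hp i) (tnth hm j) = (i == j)%:R)
  (Y : VNS R[i] l -> int -> {linear VNS R[i] l -> VNS R[i] l})
  (vertex_Y : vertex_superalgebra (@parity R[i] l) (vac R[i] l) Y)
  (gen_Y : generating_fields A eps Y) :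
  let hpC i := map_mx (real_complex R) (tnth hp i) in
  let hmC i := map_mx (real_complex R) (tnth hm i) in
  let om := omega A hpC hmC in
  let tp := tau_plus A hpC in
  let tm := tau_minus A hmC in
  let jj := jvec R[i] l in
  let pi := @Ppi R[i] (VNS R[i] l) Y om tp tm jj in
  exists br : Ptilde Y om tp tm jj -> Ptilde Y om tp tm jj ->
              Ptilde Y om tp tm jj,
    (forall u v : P00 Y om tp tm jj,
      exists2 w : P00 Y om tp tm jj,
        val w = bracket Y tp tm (val u) (val v) & br (pi u) (pi v) = pi w)
    /\ lie_algebra br.
Proof.
move=> hpC hmC om tp tm jj.
have symA : A^T = A by case: even_A.
have sc := fock_superconformal (cocycle_0r cocycle_eps) vertex_Y gen_Y
  (dual_basis_dual symA dec_L basis_hp basis_hm dual_h)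
  (dual_basis_span symA dec_L basis_hp basis_hm dual_h).
exact: (superconformal_lie vertex_Y (@parity_submod _ l) (@parity_split _ l)
  sc).
Qed.
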